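(* Let $n\ge 0$ and $t\ge 0$ be integers. Then the following hold. (i) If $p\neq 5$ is a prime such that $B_5^{(6)}(p-1)\equiv 0\pmod 5$, then $$B_5^{(6)}\left(p^{4t}n+(p^{4t}-1)\right)\equiv p^{2t}B_5^{(6)}(n)\pmod 5.$$ (ii) If $p\neq 7$ is an odd prime such that $B_7^{(6)}\left(\frac{7p-3}{2}\right)\equiv 0\pmod 7$, then $$B_7^{(6)}\left(7p^{4t}n+\frac{7p^{4t}-3}{2}\right)\equiv p^{4t}B_7^{(6)}(7n+2)\pmod 7.$$
   Context: For positive integers $\ell,r$ and an integer $n\ge 0$, $B_\ell^{(r)}(n)$ denotes the number of $\ell$-regular $r$-multipartitions of $n$, i.e. ordered $r$-tuples $(\lambda^{(1)},\dots,\lambda^{(r)})$ of (possibly empty) integer partitions, each having no part divisible by $\ell$, whose sizes sum to $n$; $B_\ell^{(r)}(0)=1$. Equivalently, as formal power series, $$\sum_{n=0}^\infty B_\ell^{(r)}(n)q^n=\frac{E_\ell^r}{E_1^r},\qquad E_k:=\prod_{m=1}^\infty(1-q^{km}).$$ *)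

(* Defs.v *)
From mathcomp Require Import all_boot.

Set Implicit Arguments.
Unset Strict Implicit.
Unset Printing Implicit Defensive.

Definition is_partition (s : seq nat) : bool := sorted geq s && (0 \notin s).

Definition is_regular_partition (l : nat) (s : seq nat) : bool :=
  is_partition s && all (fun k => ~~ (l %| k)) s.

Definition is_regular_multipartition (l r n : nat) (L : r.-tuple (seq nat)) :
    bool :=
  all (is_regular_partition l) L && (\sum_(i < r) sumn (tnth L i) == n).

Definition bseq_nat (n : nat) (s : n.-bseq 'I_n.+1) : seq nat :=
  [seq nat_of_ord k | k <- s].

(* Each component of a multipartition of n has at most n parts, all at most n,
   so restricting the components to the finite type n.-bseq 'I_n.+1 loses
   nothing; this is the content of regular_multipartitionsP below. *)
Definition B (l r n : nat) : nat :=
  #|[set L : r.-tuple (n.-bseq 'I_n.+1) |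
      is_regular_multipartition l n (map_tuple (@bseq_nat n) L)]|.

Lemma bseq_nat_inj n : injective (@bseq_nat n).
Proof. by move=> s1 s2 /(inj_map val_inj) /val_inj. Qed.

Lemma bseq_nat_surj n s :
  is_partition s -> sumn s <= n -> exists s', @bseq_nat n s' = s.
Proof.
case/andP=> _ s0 sn.
have sz : size [seq inord k : 'I_n.+1 | k <- s] <= n.
  rewrite size_map; apply: leq_trans sn.
  elim: s s0 => //= a s IHs; rewrite inE negb_or => /andP[a0 /IHs].
  by rewrite eq_sym -lt0n in a0; rewrite -add1n; apply: leq_add.
exists (Bseq sz); rewrite /bseq_nat /= -map_comp map_id_in // => k ks /=.
rewrite inordK // ltnS; apply: leq_trans sn.
elim: s ks {s0 sz} => //= a s IHs; rewrite inE => /orP[/eqP->|/IHs].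
  exact: leq_addr.
by move=> h; apply: leq_trans h (leq_addl _ _).
Qed.

Lemma regular_multipartitionsP l r n :
  exists s : seq (r.-tuple (seq nat)),
    [/\ uniq s, size s = B l r n
      & forall L, (L \in s) = is_regular_multipartition l n L].
Proof.
pose f (L : r.-tuple (n.-bseq 'I_n.+1)) := map_tuple (@bseq_nat n) L.
have f_inj : injective f.
  by move=> L1 L2 /(congr1 val) /(inj_map (@bseq_nat_inj n)) /val_inj.
pose A := [set L | is_regular_multipartition l n (f L)].
exists [seq f L | L <- enum A]; split.
- by rewrite map_inj_uniq ?enum_uniq.
- by rewrite size_map -cardE.
move=> L; apply/mapP/idP => [[L' + ->]|LP]; first by rewrite mem_enum inE.
have /fin_all_exists[g gP] i : exists s', @bseq_nat n s' = tnth L i.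
  case/andP: LP => /all_tnthP/(_ i)/andP[Pi _] /eqP sn.
  by apply: bseq_nat_surj => //; rewrite -sn (bigD1 i) //= leq_addr.
have fg : f [tuple g i | i < r] = L.
  by apply: eq_from_tnth => i; rewrite tnth_map tnth_mktuple.
by exists [tuple g i | i < r]; rewrite // mem_enum inE fg.
Qed.

(* Main.v *)
(* Let E_k be the Euler product of (1 - q^(km)) over m >= 1 and theta = q d/dq.

   (i) Modulo 5 the generating function is E_5^6 / E_1^6 = E_1^24, so B(n) is
   Ramanujan's tau(n+1). The elementary convolution identities for divisor sums
   give 3 theta E4 = E2 E4 - E6 and 2 theta E6 = E2 E6 - E4^2; hence
   E4^3 - E6^2 = 1728 q E_1^24, and reduction mod 5 gives tau(n) = n sigma(n).
   The claim follows from the recurrence of sigma along powers of p.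

   (ii) Modulo 7 the generating function is E_7^5 E_1. The exponents congruent to
   2 mod 7 in the pentagonal number series E_1 contribute - q^2 E_49, so B(7n+2) is
   minus the coefficient of q^n in E_1^12 = (E_1^3)^4. By Jacobi's formula for
   E_1^3 the latter is a sum over quadruples of odd integers, which quaternion
   multiplication by (-1 +- i +- j +- k) turns into a sum h(2n+1) of a harmonic quartic
   over Lipschitz quaternions of norm 2n+1. Writing the quartic with the squared
   entries of the rotation matrices, which become multiplicative after averaging
   over the units, and counting the factorizations of a quaternion of norm pN as
   (norm N)(norm p) -- 8 if p does not divide it, 8(p+1) otherwise -- yields the
   Hecke relation h(N) h(p) = 8 (h(pN) + p^5 h(N/p)). If 7 | h(p), then
   h(p^4 N) = p^10 h(N) = p^4 h(N) mod 7. *)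
Require Import Defs.
From mathcomp Require Import all_boot all_order all_algebra all_fingroup.
From mathcomp Require Import finfield mxabelem.
From mathcomp Require Import zify ring.

Set Implicit Arguments.
Unset Strict Implicit.
Unset Printing Implicit Defensive.

Import Order.TTheory GRing.Theory Num.Theory.
Local Open Scope ring_scope.

(** * Power series modulo X^N *)

Section TruncatedSeries.
Variable R : comNzRingType.
Implicit Types (p q r u : {poly R}) (N : nat).

(** Both parts rest on a Hecke recurrence along powers of p. The theory of modular forms gets it
    from the fact that q E_1^24 and q E_1(q^2)^12 span one-dimensional spaces of cusp forms. Here,
    modulo 5 it is traded for the recurrence of sigma. In (ii) it is proved over the integers: a
    quartic summed over a four-dimensional lattice has weight 2 + 4 = 6, whence the p^5. The
    obstacle in (ii) is that division with remainder among Lipschitz quaternions can be iterated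
    only through odd norms. The number 8(p + 1) of quaternions of norm p is found by comparison with
    singular matrices over F_p. The hypotheses make the Hecke eigenvalue vanish. In (i) they force p
    = -1 mod 5. In (ii) each p^2 contributes -p^5, so the sign disappears at p^4. Power series are
    replaced by polynomials compared below a degree N, and quotients by products. *)

Definition eqmX N p q := forall i, (i < N)%N -> p`_i = q`_i.

Lemma eqmXP N p q : eqmX N p q <-> exists r, p = q + r * 'X^N.
Proof.
split=> [pq|[r ->] i iN]; last by rewrite coefD coefMXn iN addr0.
exists (drop_poly N (p - q)); apply/polyP => i.
rewrite coefD coefMXn coef_drop_poly; case: ltnP => iN; first by rewrite pq ?addr0.
by rewrite subnK // coefB addrC subrK.
Qed.

Lemma eqmX_refl N p : eqmX N p p. Proof. by []. Qed.

Lemma eqmX_sym N p q : eqmX N p q -> eqmX N q p.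
Proof. by move=> h i /h. Qed.

Lemma eqmX_trans N q p r : eqmX N p q -> eqmX N q r -> eqmX N p r.
Proof. by move=> h1 h2 i iN; rewrite h1 // h2. Qed.

Lemma eqmX_le M N p q : (M <= N)%N -> eqmX N p q -> eqmX M p q.
Proof. by move=> MN h i iM; apply: h; apply: leq_trans MN. Qed.

Lemma eqmXD N p p' q q' :
  eqmX N p p' -> eqmX N q q' -> eqmX N (p + q) (p' + q').
Proof. by move=> h1 h2 i iN; rewrite !coefD h1 ?h2. Qed.

Lemma eqmXN N p p' : eqmX N p p' -> eqmX N (- p) (- p').
Proof. by move=> h1 i iN; rewrite !coefN h1. Qed.

Lemma eqmXB N p p' q q' :
  eqmX N p p' -> eqmX N q q' -> eqmX N (p - q) (p' - q').
Proof. by move=> h1 h2; apply/eqmXD/eqmXN. Qed.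

Lemma eqmXM N p p' q q' :
  eqmX N p p' -> eqmX N q q' -> eqmX N (p * q) (p' * q').
Proof.
move=> /eqmXP[r ->] /eqmXP[s ->]; apply/eqmXP.
by exists (p' * s + r * q' + r * s * 'X^N); ring.
Qed.

Lemma eqmX_exp N n p q : eqmX N p q -> eqmX N (p ^+ n) (q ^+ n).
Proof. by move=> h; elim: n => // n IH; rewrite !exprS; apply: eqmXM. Qed.

Lemma eqmX_sum N (I : Type) (s : seq I) (P : pred I) (F G : I -> {poly R}) :
  (forall i, P i -> eqmX N (F i) (G i)) ->
  eqmX N (\sum_(i <- s | P i) F i) (\sum_(i <- s | P i) G i).
Proof. by move=> h; elim/big_ind2: _ => // *; apply: eqmXD. Qed.

Lemma eqmX_Xn N n : (N <= n)%N -> eqmX N 'X^n 0.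
Proof. by move=> Nn i iN; rewrite coefXn coef0 ltn_eqF // (leq_trans iN). Qed.

(** Takes the place of inverting a series with constant term 1: in the coefficient of index i of u
    (p - q), every term except that of index i of p - q vanishes by induction. *)
Lemma eqmX_mulI N p q u :
  u`_0 = 1 -> eqmX N (u * p) (u * q) -> eqmX N p q.
Proof.
move=> u0 h; have: eqmX N (u * (p - q)) 0.
  by rewrite mulrBr -(subrr (u * q)); apply: eqmXB.
move=> {}h i; have [n] := ubnP i; elim: n i => // n IH i; rewrite ltnS => lin iN.
have := h _ iN; rewrite coef0 coefM big_ord_recl u0 mul1r subn0 big1 ?addr0.
  by rewrite coefB => /eqP; rewrite subr_eq0 => /eqP.
move=> j _; rewrite coefB IH ?subrr ?mulr0 //= /bump /=; last by lia.
by have := ltn_ord j; lia.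
Qed.

End TruncatedSeries.

Lemma big_seq_bij (V : nmodType) (T T' : eqType) (s : seq T) (s' : seq T')
    (f : T -> T') (g : T' -> T) (F : T' -> V) :
  uniq s -> uniq s' ->
  (forall x, x \in s -> f x \in s') -> (forall y, y \in s' -> g y \in s) ->
  (forall x, x \in s -> g (f x) = x) -> (forall y, y \in s' -> f (g y) = y) ->
  \sum_(y <- s') F y = \sum_(x <- s) F (f x).
Proof.
move=> us us' fs gs fK gK.
rewrite -(big_map f xpredT F); apply: perm_big; apply: uniq_perm => //.
  by rewrite map_inj_in_uniq // => x y /fK {2}<- /fK {2}<- ->.
move=> y; apply/idP/mapP => [ys|[x xs ->]]; last exact: fs.
by exists (g y); rewrite ?gK ?gs.
Qed.

Lemma uniq_pairs (T U : eqType) (s : seq T) (t : seq U) :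
  uniq s -> uniq t -> uniq (allpairs pair s t).
Proof.
by move=> us ut; apply: allpairs_uniq => // -[? ?] [? ?] _ _ [-> ->].
Qed.

Lemma mem_pairs (T U : eqType) (s : seq T) (t : seq U) u v :
  ((u, v) \in allpairs pair s t) = (u \in s) && (v \in t).
Proof.
apply/allpairsP/andP => [[[u' v'] /= [us vt [-> ->]]]|[us vt]] //.
by exists (u, v).
Qed.

(** * Euler products: the pentagonal number theorem and Jacobi's cube *)

Definition tri (k : nat) : nat := 'C(k.+1, 2).

Lemma triS k : tri k.+1 = (tri k + k.+1)%N.
Proof. by rewrite /tri binS bin1. Qed.

Lemma tri0 : tri 0 = 0%N. Proof. by []. Qed.

Lemma leq_tri k : (k <= tri k)%N.
Proof. by elim: k => // k IH; rewrite triS; lia. Qed.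

Section EulerProduct.
Variable R : comNzRingType.

Definition euler (k n : nat) : {poly R} := \prod_(1 <= i < n.+1) (1 - 'X^(k * i)).

Lemma euler0 k : euler k 0 = 1.
Proof. by rewrite /euler big_geq. Qed.

Lemma eulerS k n : euler k n.+1 = euler k n * (1 - 'X^(k * n.+1)).
Proof. by rewrite /euler big_nat_recr. Qed.

Lemma euler1S n : euler 1 n.+1 = euler 1 n * (1 - 'X^(n.+1)).
Proof. by rewrite eulerS mul1n. Qed.

Lemma euler_eqmX k m n : (m <= n)%N -> eqmX (k * m.+1) (euler k n) (euler k m).
Proof.
move=> /subnK <-; elim: (n - m)%N => // j IH; rewrite addSn eulerS.
rewrite -[euler k m]mulr1; apply: eqmXM => //.
by rewrite -[X in eqmX _ _ X]subr0; apply/eqmXB/eqmX_Xn => //; nia.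
Qed.

Lemma euler1_eqmX m n : (m <= n)%N -> eqmX m.+1 (euler 1 n) (euler 1 m).
Proof. by rewrite -[m.+1]mul1n; apply: euler_eqmX. Qed.

Lemma euler_coef0 k n : (0 < k)%N -> (euler k n)`_0 = 1.
Proof. by move=> k0; rewrite (@euler_eqmX k 0) ?muln1 // euler0 coef1. Qed.

(** For k <= n, the quotient of [euler 1 n] by [euler 1 k], written without division. *)
Definition eulerI (k n : nat) : {poly R} := \prod_(k.+1 <= i < n.+1) (1 - 'X^i).

Lemma eulerI_S k n : (k <= n)%N -> eulerI k n.+1 = eulerI k n * (1 - 'X^(n.+1)).
Proof. by move=> kn; rewrite /eulerI big_nat_recr. Qed.

Lemma eulerI_l k n : (k < n)%N -> eulerI k n = (1 - 'X^(k.+1)) * eulerI k.+1 n.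
Proof. by move=> kn; rewrite /eulerI big_ltn. Qed.

Definition shanks (n k : nat) : {poly R} :=
  (-1) ^+ k * eulerI k n * 'X^(k * n + tri k).

(* Shanks' finite form of the pentagonal number theorem; the sum telescopes. *)
Lemma shanks_sum n :
  \sum_(k < n.+1) shanks n k =
  1 + \sum_(1 <= k < n.+1) (-1) ^+ k * ('X^(k ^ 2 + tri k.-1) + 'X^(k ^ 2 + tri k)).
Proof.
elim: n => [|n IH].
  by rewrite big_ord1 big_geq // /shanks /eulerI big_geq // !mul1r expr0 addr0.
rewrite big_nat_recr //= addrA -IH big_ord_recr /=.
(* Telescoping certificate: from n to n + 1 the k-th term changes by u (k - 1) - u k, with u (-1)
   read as 0. *)
pose u k := (-1) ^+ k * eulerI k n * 'X^(k.+1 * n.+1 + tri k).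
have step (k : 'I_n.+1) : shanks n.+1 k = shanks n k + ((if (k : nat) is j.+1 then u j else 0) - u k).
  have kn : (k <= n)%N by rewrite -ltnS.
  rewrite /shanks /u eulerI_S //; case: (k : nat) kn => [|j] jn.
    by rewrite tri0 !mul0n mul1n !addn0 expr0; ring.
  rewrite (eulerI_l jn) triS.
  have -> : (j.+1 * n.+1 + (tri j + j.+1) = (j * n + n + tri j + j.+1) + j.+1)%N by nia.
  have -> : (j.+1 * n + (tri j + j.+1) = j * n + n + tri j + j.+1)%N by nia.
  have -> : (j.+2 * n.+1 + (tri j + j.+1) = (j * n + n + tri j + j.+1) + j.+1 + n.+1)%N by nia.
  have -> : (j.+1 * n.+1 + tri j = j * n + n + tri j + j.+1)%N by nia.
  move: (j * n + n + tri j + j.+1)%N => e.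
  by rewrite !exprD [(-1) ^+ j.+1]exprS; ring.
rewrite (eq_bigr _ (fun k _ => step k)) big_split /= -addrA; congr (_ + _).
have -> : \sum_(k < n.+1) ((if (k : nat) is j.+1 then u j else 0) - u k) = - u n.
  rewrite sumrB big_ord_recl add0r [X in _ - X]big_ord_recr /=; ring.
rewrite /u /shanks /eulerI !big_geq // !mulr1 triS mulrDr; congr (_ + _).
  rewrite exprS mulN1r mulNr; congr (- (_ * 'X^_)); nia.
Qed.

(** In Shanks' sum the term k = 0 is [euler 1 n]; the others carry X^(kn + tri k) and vanish modulo
    X^(n+1). *)
Theorem euler_pentagonal n : eqmX n.+1 (euler 1 n)
  (1 + \sum_(1 <= k < n.+1) (-1) ^+ k * ('X^(k ^ 2 + tri k.-1) + 'X^(k ^ 2 + tri k))).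
Proof.
rewrite -shanks_sum big_ord_recl /= -[X in eqmX _ X]addr0; apply: eqmXD.
  rewrite /shanks mul0n tri0 expr0 mul1r mulr1 /euler /eulerI.
  by under eq_bigr do rewrite mul1n.
apply: eqmX_sym; have z : \sum_(i < n) (0 : {poly R}) = 0 by rewrite big1.
rewrite -[X in eqmX _ _ X]z.
apply: eqmX_sum => i _; rewrite /shanks -[X in eqmX _ _ X](mulr0 ((-1) ^+ lift ord0 i * eulerI (lift ord0 i) n)).
apply: eqmXM => //; apply: eqmX_Xn; rewrite (_ : bump 0 i = i.+1) // triS; nia.
Qed.

(* [jac n k] = (-1)^k X^(tri k) [2n+1 choose n-k]_X is the coefficient of z^k in
   prod_(1 <= i <= n) (1 - z X^i) * prod_(0 <= i <= n) (1 - X^i / z); the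
   coefficient of z^(-1-k) is its opposite, so that dividing by 1 - 1/z and
   setting z = 1 gives [jac_sum]. *)
Fixpoint jac (n k : nat) : {poly R} :=
  if n is m.+1 then
    (1 + 'X^(2 * m.+1)) * jac m k
      - 'X^(m.+1) * ((if k is j.+1 then jac m j else - jac m 0) + jac m k.+1)
  else (k == 0)%:R.

Lemma jac_gt n k : (n < k)%N -> jac n k = 0.
Proof.
elim: n k => [|n IH] [|k] //= nk.
by rewrite !IH ?(ltnW nk) //; [ring|lia].
Qed.

(** The weight 2k + 1 is the mean of its neighbours 2k - 1 and 2k + 3, so the two shifts together
    double the weighted sum; the boundary value - [jac m 0] supplies the missing weight -1 at k = 0.
    Each step thus multiplies by 1 - 2 X^(m+1) + X^(2m+2), a square. *)
Lemma jac_sum n : \sum_(k < n.+1) jac n k *+ k.*2.+1 = euler 1 n ^+ 2.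
Proof.
elim: n => [|n IH]; first by rewrite big_ord1 euler0 expr1n.
have ext m : \sum_(k < n.+1 + m) jac n k *+ k.*2.+1 = euler 1 n ^+ 2.
  rewrite -IH big_split_ord /= [X in _ + X]big1 ?addr0 // => i _.
  by rewrite jac_gt ?mul0rn //; lia.
have e0 := ext 1%N; rewrite addn1 in e0.
transitivity ((1 + 'X^(2 * n.+1)) * \sum_(k < n.+2) jac n k *+ k.*2.+1
   - 'X^(n.+1) * (\sum_(k < n.+2) (if (k : nat) is j.+1 then jac n j else - jac n 0) *+ k.*2.+1
      + \sum_(k < n.+2) jac n k.+1 *+ k.*2.+1)).
  rewrite -big_split /= !mulr_sumr -sumrB; apply: eq_bigr => k _.
  by rewrite /=; ring.
have -> : \sum_(k < n.+2) (if (k : nat) is j.+1 then jac n j else - jac n 0) *+ k.*2.+1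
      + \sum_(k < n.+2) jac n k.+1 *+ k.*2.+1 = 2 * \sum_(k < n.+2) jac n k *+ k.*2.+1.
  (* The predecessor truncates to 0 at k = 0, so this index contributes nothing here. *)
  have -> : \sum_(k < n.+2) jac n k.+1 *+ k.*2.+1 =
      \sum_(k < n.+2) jac n k *+ k.*2.-1.
    rewrite big_ord_recr /= [jac n n.+2]jac_gt // mul0rn addr0.
    by rewrite [RHS]big_ord_recl mulr0n add0r.
  have -> : \sum_(k < n.+2) (if (k : nat) is j.+1 then jac n j else - jac n 0) *+ k.*2.+1
     = - jac n 0 + \sum_(k < n.+2) jac n k *+ k.*2.+3.
    rewrite big_ord_recl /= mulr1n; congr (_ + _).
    by rewrite [RHS]big_ord_recr /= [jac n n.+1]jac_gt // mul0rn addr0.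
  rewrite -addrA -big_split /= mulr_sumr big_ord_recl [in RHS]big_ord_recl /=.
  rewrite addrA; congr (_ + _); first by rewrite double0; ring.
  apply: eq_bigr => i _ /=; rewrite -mulrnDr mulr_natl -mulrnA; congr (_ *+ _); rewrite /bump /=; lia.
rewrite e0 euler1S mul2n -addnn exprD; ring.
Qed.

Lemma jac_closed n k : (k <= n)%N ->
  jac n k * (euler 1 (n - k) * euler 1 (n + k.+1)) =
  (-1) ^+ k * 'X^(tri k) * euler 1 n.*2.+1.
Proof.
elim: n k => [|n IH] k kn.
  by have -> : k = 0%N by [lia]; rewrite /= subn0 euler0 tri0; ring.
(* [main], [down] and [up] bring the three terms of the recursion over the denominator of row n + 1.
   Where [jac] is out of range, a factor 1 - X^0 makes the right side vanish too. *)
have main j : (j <= n.+1)%N -> jac n j * (euler 1 (n.+1 - j) * euler 1 (n + j.+2)) =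
    (-1) ^+ j * 'X^(tri j) * euler 1 n.*2.+1 * (1 - 'X^(n.+1 - j)) * (1 - 'X^(n + j.+2)).
  rewrite leq_eqVlt => /predU1P[->|jn].
    by rewrite jac_gt // subnn expr0; ring.
  by rewrite -IH // subSn // addnS !euler1S; ring.
have down j : (j <= n)%N -> jac n j * (euler 1 (n - j) * euler 1 (n + j.+3)) =
    (-1) ^+ j * 'X^(tri j) * euler 1 n.*2.+1 * (1 - 'X^(n + j.+2)) * (1 - 'X^(n + j.+3)).
  by move=> jn; rewrite -IH // 2![in LHS]addnS !euler1S ?addnS; ring.
have up j : (j <= n.+1)%N -> jac n j.+1 * (euler 1 (n.+1 - j) * euler 1 (n + j.+2)) =
    (-1) ^+ j.+1 * 'X^(tri j.+1) * euler 1 n.*2.+1 * (1 - 'X^(n - j)) * (1 - 'X^(n.+1 - j)).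
  move=> jn; have [jn'|nj] := ltnP j n.
    have e : (n - j = (n - j.+1).+1)%N by lia.
    have e' : (n.+1 - j = (n - j.+1).+2)%N by lia.
    by rewrite -IH // e e' !euler1S; ring.
  by rewrite jac_gt // (_ : n - j = 0)%N ?expr0; [ring|lia].
have fin : euler 1 n.+1.*2.+1 = euler 1 n.*2.+1 * (1 - 'X^(n.*2.+2)) * (1 - 'X^(n.*2.+3)).
  by rewrite doubleS !euler1S.
have -> : (n.+1 + k.+1 = n + k.+2)%N by rewrite addSnnS.
rewrite /= mulrBl -[_ * jac n k * _]mulrA main // -[X in _ - X]mulrA [in X in _ - X]mulrDl up // fin.
case: k kn => [|j] jn.
  rewrite mulNr main // triS tri0 expr0 expr1.
  rewrite !(mul2n, subn0, addn0, addnS, addSn, add0n, doubleS) -!addnn !exprS !exprD !expr0.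
  ring.
rewrite subSS down // !triS; have [m ->] : exists m, n = (m + j)%N.
  by exists (n - j)%N; lia.
rewrite addnK; case: m => [|m].
  rewrite !add0n (_ : j - j.+1 = 0)%N; last by lia.
  rewrite !(mul2n, subn0, addn0, addnS, addSn, add0n, doubleS) -!addnn !exprS !exprD !expr0.
  ring.
rewrite (_ : m.+1 + j - j.+1 = m)%N; last by lia.
rewrite !(mul2n, addnS, addSn, doubleS, doubleD) -!addnn !exprS !exprD.
ring.
Qed.

Theorem jacobi_cube n :
  eqmX n.+1 (euler 1 n ^+ 3)
    (\sum_(k < n.+1) ((-1) ^+ k * 'X^(tri k)) *+ k.*2.+1).
Proof.
rewrite exprSr -jac_sum mulr_suml; apply: eqmX_sum => k _.
have kn : (k <= n)%N by rewrite -ltnS.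
rewrite mulrnAl -[X in eqmX _ X]mulr_natl -[X in eqmX _ _ X]mulr_natl; apply: eqmXM => //.
apply: (@eqmX_mulI _ _ _ _ (euler 1 (n - k) * euler 1 (n + k.+1))).
  by rewrite coef0M !euler_coef0 ?mulr1.
rewrite mulrA [_ * jac n k]mulrC jac_closed // -[_ * _ * euler 1 n]mulrA.
rewrite [X in eqmX _ _ X]mulrC; apply/eqmXP.
have /eqmXP[r rE] := @euler1_eqmX (n + k.+1) n.*2.+1 ltac:(lia).
have /eqmXP[s sE] := @euler1_eqmX (n - k) n (leq_subr _ _).
rewrite rE sE; have -> : ((n + k.+1).+1 = n.+1 + k.+1)%N by lia.
(* Replacing [euler 1 n] by [euler 1 (n - k)] loses k degrees of precision; X^(tri k) restores them
   because tri k >= k. *)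
have [t tE] : exists t, (tri k + (n - k).+1 = t + n.+1)%N.
  by exists (tri k - k)%N; have := leq_tri k; lia.
exists ((-1) ^+ k * ('X^(tri k) * r * 'X^(k.+1) * (euler 1 (n - k) + s * 'X^((n - k).+1)) +
  euler 1 (n + k.+1) * s * 'X^t)).
have e : 'X^(tri k) * 'X^((n - k).+1) = 'X^t * 'X^(n.+1) :> {poly R} by rewrite -!exprD tE.
rewrite exprD; ring: e.
Qed.

End EulerProduct.

(** * Convolution sums of divisor functions *)

Section ConvolutionSums.
Variable N : nat.
Local Notation box := (iota 1 N).

Definition pairs (n : nat) (G : nat -> nat -> int) : int :=
  \sum_(a <- box) \sum_(m <- box | (a * m == n)%N) G a m.

Lemma pairsC n G : pairs n G = pairs n (fun a m => G m a).
Proof.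
rewrite /pairs (exchange_big_dep xpredT) //=.
by apply: eq_bigr => a _; apply: eq_bigl => m; rewrite mulnC.
Qed.

Lemma eq_pairs n G H :
  (forall a m, (0 < a)%N -> (0 < m)%N -> (a * m)%N = n -> G a m = H a m) ->
  pairs n G = pairs n H.
Proof.
move=> e; rewrite /pairs; apply: eq_big_seq => a; rewrite mem_iota => /andP[a0 _].
rewrite big_seq_cond [RHS]big_seq_cond; apply: eq_bigr => m.
by rewrite mem_iota => /andP[/andP[m0 _] /eqP]; apply: e.
Qed.

Lemma pairsD n G H : pairs n (fun a m => G a m + H a m) = pairs n G + pairs n H.
Proof.
by rewrite -big_split /=; apply: eq_bigr => a _; rewrite big_split.
Qed.

Lemma pairsZ n c G : pairs n (fun a m => c * G a m) = c * pairs n G.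
Proof. by rewrite /pairs mulr_sumr; apply: eq_bigr => a _; rewrite mulr_sumr. Qed.

Definition sols (n : nat) : seq (nat * nat * nat * nat) :=
  [seq q <- allpairs pair (allpairs pair (allpairs pair box box) box) box
  | (q.1.1.1 * q.1.2 + q.1.1.2 * q.2 == n)%N].

Lemma sols_uniq n : uniq (sols n).
Proof. by rewrite filter_uniq ?uniq_pairs ?iota_uniq. Qed.

Lemma mem_sols n a b x y : (n <= N)%N -> ((a, b, x, y) \in sols n) =
  [&& (0 < a)%N, (0 < b)%N, (0 < x)%N, (0 < y)%N & (a * x + b * y == n)%N].
Proof.
move=> nN; rewrite mem_filter !mem_pairs !mem_iota /=; apply/idP/idP; first by case/andP; lia.
by case/and5P=> a0 b0 x0 y0 /eqP e; rewrite e eqxx /=; nia.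
Qed.

Lemma sum_sols n (F : nat -> nat -> nat -> nat -> int) :
  \sum_(q <- sols n) F q.1.1.1 q.1.1.2 q.1.2 q.2 =
  \sum_(a <- box) \sum_(b <- box) \sum_(x <- box) \sum_(y <- box | (a * x + b * y == n)%N) F a b x y.
Proof.
rewrite /sols big_filter big_mkcond !big_allpairs /=.
by do 3! (apply: eq_bigr => ? _); rewrite -big_mkcond.
Qed.

Lemma mem_filter_sols n P q : (q \in [seq q <- sols n | P q]) = P q && (q \in sols n).
Proof. exact: mem_filter. Qed.

Lemma sols_shift n (h : nat -> nat -> int) : (n <= N)%N ->
  \sum_(q <- sols n | (q.1.2 < q.2)%N) h q.1.1.1 q.1.1.2 =
  \sum_(q <- sols n | (q.1.1.2 < q.1.1.1)%N) h (q.1.1.1 - q.1.1.2)%N q.1.1.2.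
Proof.
move=> nN; rewrite -big_filter -[RHS]big_filter.
pose f (q : nat * nat * nat * nat) :=
  let: (a, b, x, y) := q in ((a - b)%N, b, x, (x + y)%N).
pose g (q : nat * nat * nat * nat) :=
  let: (a, b, x, y) := q in ((a + b)%N, b, x, (y - x)%N).
set s := filter _ _; set s' := filter _ _.
have us : uniq s by rewrite filter_uniq ?sols_uniq.
have us' : uniq s' by rewrite filter_uniq ?sols_uniq.
rewrite (@big_seq_bij _ _ _ s' s f g) //.
- by apply: eq_bigr => -[[[a b] x] y].
- move=> [[[a b] x] y]; rewrite !mem_filter_sols !mem_sols //=.
  by case/andP=> ba /and5P[a0 b0 x0 y0 /eqP e]; apply/andP; split; nia.
- move=> [[[a b] x] y]; rewrite !mem_filter_sols !mem_sols //=.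
  by case/andP=> xy /and5P[a0 b0 x0 y0 /eqP e]; apply/andP; split; nia.
- move=> [[[a b] x] y]; rewrite mem_filter_sols /= => /andP[ba _].
  by congr (_, _, _, _); lia.
- move=> [[[a b] x] y]; rewrite mem_filter_sols /= => /andP[ba _].
  by congr (_, _, _, _); lia.
Qed.

Lemma sols_swap n (P : rel nat) (h : nat -> nat -> int) : (n <= N)%N ->
  (forall a b, h a b = h b a) ->
  \sum_(q <- sols n | P q.1.1.1 q.1.1.2) h q.1.1.1 q.1.1.2 =
  \sum_(q <- sols n | P q.1.1.2 q.1.1.1) h q.1.1.1 q.1.1.2 /\
  \sum_(q <- sols n | P q.1.2 q.2) h q.1.1.1 q.1.1.2 =
  \sum_(q <- sols n | P q.2 q.1.2) h q.1.1.1 q.1.1.2.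
Proof.
move=> nN hC; pose f (q : nat * nat * nat * nat) :=
  let: (a, b, x, y) := q in (b, a, y, x).
have fK : cancel f f by move=> [[[? ?] ?] ?].
have fs q : q \in sols n -> f q \in sols n.
  by move: q => [[[a b] x] y]; rewrite !mem_sols //=; lia.
have E (F : nat * nat * nat * nat -> int) :
    \sum_(q <- sols n) F q = \sum_(q <- sols n) F (f q).
  by apply: (big_seq_bij (g := f)); rewrite ?sols_uniq.
by split; rewrite big_mkcond E -big_mkcond /=; apply: eq_big => -[[[? ?] ?] ?] //=.
Qed.

Lemma sum_by_total n x (h : nat -> nat -> int) : (0 < x)%N -> (n <= N)%N ->
  \sum_(a <- box) \sum_(b <- box | (x * (a + b) == n)%N) h a b =
  \sum_(m <- box | (x * m == n)%N) \sum_(1 <= a < m) h a (m - a)%N.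
Proof.
move=> x0 nN.
transitivity (\sum_(a <- box) \sum_(m <- box | (x * m == n)%N && (a < m)%N) h a (m - a)%N).
  apply: eq_big_seq => a; rewrite mem_iota => /andP[a0 aN].
  rewrite -[LHS]big_filter -[RHS]big_filter.
  apply: (big_seq_bij (f := fun m => (m - a)%N) (g := fun b => (a + b)%N) (fun b => h a b));
    rewrite ?filter_uniq ?iota_uniq //.
  - move=> m; rewrite !mem_filter !mem_iota => /andP[/andP[/eqP e am] /andP[m0 mN]].
    by rewrite subnKC ?(ltnW am) // e eqxx /=; lia.
  - move=> b; rewrite !mem_filter !mem_iota => /andP[/eqP e /andP[b0 bN]].
    by rewrite e eqxx /=; nia.
  - by move=> m; rewrite mem_filter => /andP[/andP[_ am] _]; rewrite subnKC ?(ltnW am).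
  - by move=> b _; rewrite addKn.
rewrite (exchange_big_dep (fun m => (x * m == n)%N)) /=; last by move=> i m _ /andP[].
rewrite big_seq_cond [RHS]big_seq_cond; apply: eq_bigr => m.
rewrite mem_iota => /andP[/andP[m0 mN] ->] /=.
rewrite -big_filter; apply: perm_big; apply: uniq_perm.
- by rewrite filter_uniq ?iota_uniq.
- exact: iota_uniq.
by move=> a; rewrite mem_filter mem_index_iota mem_iota; lia.
Qed.

(* The Euclidean step (a, b, x, y) |-> (a - b, b, x, x + y) maps solutions of
   ax + by = n with a > b to those with x < y. *)
Lemma convolution_identity n (h f : nat -> nat -> int) : (n <= N)%N ->
  (forall a b, h a b = h b a) -> (forall a b, f a b = f b a) ->
  (forall a b, (b < a)%N -> f a b = h a b - h (a - b)%N b) ->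
  \sum_(q <- sols n) f q.1.1.1 q.1.1.2 =
  pairs n (fun a m => (f a a - h a a) * (m%:Z - 1)) +
  pairs n (fun _ m => \sum_(1 <= a < m) h a (m - a)%N).
Proof.
move=> nN hC fC fh.
pose S (P : pred (nat * nat * nat * nat)) (k : nat -> nat -> int) :=
  \sum_(q <- sols n | P q) k q.1.1.1 q.1.1.2.
(* Split by a against b and by x against y. By symmetry the sum of f is twice its part a > b plus
   its diagonal, and the part a > b is that of h minus the part x < y of h. Comparing the two
   splittings of the sum of h leaves only f - h on a = b and h on x = y. *)
have tri3 (u : nat * nat * nat * nat -> nat) v k :
    S xpredT k = S (fun q => (u q < v q)%N) k + S (fun q => (v q < u q)%N) k
      + S (fun q => u q == v q) k.
  rewrite /S (bigID (fun q => (u q < v q)%N)) /= -addrA; congr (_ + _).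
  rewrite (bigID (fun q => (v q < u q)%N)) /=; congr (_ + _); apply: eq_bigl => q; lia.
have h1 := tri3 (fun q => q.1.1.1) (fun q => q.1.1.2) h.
have h2 := tri3 (fun q => q.1.2) (fun q => q.2) h.
have f1 := tri3 (fun q => q.1.1.1) (fun q => q.1.1.2) f.
have sw1 : S (fun q => (q.1.1.1 < q.1.1.2)%N) h = S (fun q => (q.1.1.2 < q.1.1.1)%N) h.
  exact: (proj1 (sols_swap ltn nN hC)).
have sw2 : S (fun q => (q.1.2 < q.2)%N) h = S (fun q => (q.2 < q.1.2)%N) h.
  exact: (proj2 (sols_swap ltn nN hC)).
have sw3 : S (fun q => (q.1.1.1 < q.1.1.2)%N) f = S (fun q => (q.1.1.2 < q.1.1.1)%N) f.
  exact: (proj1 (sols_swap ltn nN fC)).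
have fe : S (fun q => (q.1.1.2 < q.1.1.1)%N) f = S (fun q => (q.1.1.2 < q.1.1.1)%N) h -
    S (fun q => (q.1.2 < q.2)%N) h.
  rewrite /S [X in _ - X](sols_shift h nN) -sumrB.
  by apply: eq_bigr => q; apply: fh.
(* On a = b the equation is a (x + y) = n, and x + y = m has m - 1 solutions. *)
have -> : pairs n (fun a m => (f a a - h a a) * (m%:Z - 1)) =
    S (fun q => q.1.1.1 == q.1.1.2) f - S (fun q => q.1.1.1 == q.1.1.2) h.
  rewrite /S -sumrB.
  transitivity (\sum_(q <- sols n) (if q.1.1.1 == q.1.1.2 then f q.1.1.1 q.1.1.1 - h q.1.1.1 q.1.1.1 else 0)).
    rewrite (sum_sols n (fun a b x y => if a == b then f a a - h a a else 0)).
    apply: eq_big_seq => a; rewrite mem_iota => /andP[a0 aN].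
    rewrite (bigD1_seq a) ?iota_uniq ?mem_iota ?a0 //= [X in _ = _ + X]big1 ?addr0; last first.
      by move=> b ba; rewrite big1 // => x _; rewrite big1 // => y _; rewrite eq_sym (negPf ba).
    rewrite eqxx; under [RHS]eq_bigr do under eq_bigl do rewrite -mulnDr.
    rewrite (sum_by_total (fun _ _ => f a a - h a a)) //.
    rewrite big_seq_cond [RHS]big_seq_cond; apply: eq_bigr => m.
    rewrite mem_iota => /andP[/andP[m0 mN] _].
    by rewrite sumr_const_nat -mulr_natr; congr (_ * _); rewrite natrB // natz.
  rewrite [RHS]big_mkcond /=.
  by apply: eq_bigr => q _; case: eqP => // <-.
have -> : pairs n (fun _ m => \sum_(1 <= a < m) h a (m - a)%N) = S (fun q => q.1.2 == q.2) h.
  rewrite /S big_mkcond (sum_sols n (fun a b x y => if x == y then h a b else 0)).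
  transitivity (\sum_(x <- box) \sum_(a <- box) \sum_(b <- box | (x * (a + b) == n)%N) h a b).
    by apply: eq_big_seq => x; rewrite mem_iota => /andP[x0 _]; rewrite sum_by_total.
  rewrite exchange_big /=; apply: eq_bigr => a _.
  rewrite (exchange_big_dep xpredT) //=; apply: eq_bigr => b _.
  rewrite [LHS]big_mkcond /=; apply: eq_big_seq => x xb.
  rewrite big_mkcond /= (bigD1_seq x) ?iota_uniq //= eqxx big1 ?addr0; last first.
    by move=> y yx; rewrite [x == y]eq_sym (negPf yx); case: ifP.
  by rewrite mulnDr ![(x * _)%N]mulnC.
rewrite -[LHS]/(S xpredT f) f1 sw3 fe; rewrite h1 sw1 in h2; rewrite sw2 in h2 *.
by move: h2; do ! (move: (S _ _) => ?); lia.
Qed.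

End ConvolutionSums.

Lemma sum_telescope (G : nat -> int) (c : int) (F : nat -> int) (m : nat) :
  (0 < m)%N -> (forall a, (a < m)%N -> c * F a = G a.+1 - G a) ->
  c * \sum_(1 <= a < m) F a = G m - G 1%N.
Proof.
move=> m0 e; rewrite mulr_sumr -telescope_sumr //.
by apply: eq_big_nat => a /andP[_]; apply: e.
Qed.

Lemma power_sum4 (m : nat) : (0 < m)%N ->
  30 * \sum_(1 <= a < m) (let b := (m - a)%N in (a%:Z ^+ 2 + a%:Z * b%:Z + b%:Z ^+ 2) ^+ 2)
  = 21 * m%:Z ^+ 5 - 30 * m%:Z ^+ 4 + 10 * m%:Z ^+ 3 - m%:Z.
Proof.
(* With b = d - a the summand is a^4 - 2 d a^3 + 3 d^2 a^2 - 2 d^3 a + d^4; G collects 30 times the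
   corresponding sums of powers below a. *)
move=> m0; pose G (n : nat) := let a := n%:Z in let d := m%:Z in
  (6 * a ^+ 5 - 15 * a ^+ 4 + 10 * a ^+ 3 - a) - 15 * d * (a ^+ 4 - 2 * a ^+ 3 + a ^+ 2)
  + 15 * d ^+ 2 * (2 * a ^+ 3 - 3 * a ^+ 2 + a) - 30 * d ^+ 3 * (a ^+ 2 - a) + 30 * d ^+ 4 * a.
rewrite (sum_telescope (G := G) m0) => [|a am]; first by rewrite /G /=; ring.
by rewrite /G /= -subzn ?(ltnW am) // intS; ring.
Qed.

(* The coefficients make [h6 a b - h6 (a - b) b] symmetric and equal to a multiple
   of 21 (a^5 b + a b^5) - 200 a^3 b^3, the combination of convolutions that
   occurs in 2 theta E6 = E2 E6 - E4^2. *)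
Definition h6 (x y : int) : int :=
  14 * (x ^+ 6 + y ^+ 6) + 42 * (x ^+ 5 * y + x * y ^+ 5)
  - 165 * (x ^+ 4 * y ^+ 2 + x ^+ 2 * y ^+ 4) - 400 * x ^+ 3 * y ^+ 3.

Lemma power_sum6 (m : nat) : (0 < m)%N ->
  6 * \sum_(1 <= a < m) h6 a (m - a)%N
  = - 84 * m%:Z ^+ 6 + 42 * m%:Z ^+ 5 + 40 * m%:Z ^+ 3 + 2 * m%:Z.
Proof.
(* The polynomial antidifference of 6 [h6] a (d - a) that vanishes at a = 0. *)
move=> m0; pose G (n : nat) := let a := n%:Z in let d := m%:Z in
  84 * a * d ^+ 6 - 126 * a ^+ 2 * d ^+ 5 + 126 * a * d ^+ 5 - 330 * a ^+ 3 * d ^+ 4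
  + 495 * a ^+ 2 * d ^+ 4 - 165 * a * d ^+ 4 + 600 * a ^+ 4 * d ^+ 3
  - 1200 * a ^+ 3 * d ^+ 3 + 600 * a ^+ 2 * d ^+ 3 - 198 * a ^+ 5 * d ^+ 2
  + 495 * a ^+ 4 * d ^+ 2 - 330 * a ^+ 3 * d ^+ 2 + 33 * a * d ^+ 2 - 42 * a ^+ 6 * d
  + 126 * a ^+ 5 * d - 105 * a ^+ 4 * d + 21 * a ^+ 2 * d + 12 * a ^+ 7 - 42 * a ^+ 6
  + 42 * a ^+ 5 - 14 * a ^+ 3 + 2 * a.
rewrite (sum_telescope (G := G) m0) => [|a am]; first by rewrite /G /=; ring.
by rewrite /G /h6 /= -subzn ?(ltnW am) // intS; ring.
Qed.

(** * Divisor power sums and Ramanujan's differential equations *)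

Section Eisenstein.
Variable N : nat.
Local Notation box := (iota 1 N).

(** Up to degree N, the Lambert series of sigma_i; higher coefficients are incomplete. E2, E4 and E6
    appear as 1 - 24 [eis 1], 1 + 240 [eis 3] and 1 - 504 [eis 5]. *)
Definition eis (i : nat) : {poly int} :=
  \sum_(a <- box) \sum_(m <- box) (a%:Z ^+ i) *: 'X^(a * m).

Lemma coef_eis i n : (eis i)`_n = pairs N n (fun a _ => a%:Z ^+ i).
Proof.
rewrite /eis /pairs coef_sum; apply: eq_bigr => a _.
rewrite coef_sum [RHS]big_mkcond; apply: eq_bigr => m _.
by rewrite coefZ coefXn eq_sym; case: eqP => _; rewrite ?mulr1 ?mulr0.
Qed.

Lemma coef_eisM i j n : (eis i * eis j)`_n =
  \sum_(q <- sols N n) q.1.1.1%:Z ^+ i * q.1.1.2%:Z ^+ j.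
Proof.
rewrite (sum_sols N n (fun a b _ _ => a%:Z ^+ i * b%:Z ^+ j)) /eis mulr_suml coef_sum.
apply: eq_bigr => a _; rewrite mulr_sumr coef_sum; apply: eq_bigr => b _.
rewrite mulr_suml coef_sum; apply: eq_bigr => x _.
rewrite mulr_sumr coef_sum [RHS]big_mkcond; apply: eq_bigr => y _.
rewrite -scalerAl -scalerAr scalerA -exprD coefZ coefXn eq_sym.
by case: eqP => _; rewrite ?mulr1 ?mulr0.
Qed.

Lemma coef_eis_deriv i n : ('X * (eis i)^`())`_n = n%:Z * (eis i)`_n.
Proof.
rewrite coefXM coef_deriv; case: n => [|n] /=; first by rewrite mul0r.
by rewrite -mulr_natl natz.
Qed.

(* This is Ramanujan's identity 3 theta E4 = E2 E4 - E6. *)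
Lemma eis_conv13 : eqmX N.+1 (240 * (eis 1 * eis 3))
  (21 * eis 5 + 10 * eis 3 - eis 1 - 30 * ('X * (eis 3)^`())).
Proof.
move=> n; rewrite ltnS => nN; rewrite !coefB coefD.
have cE (k : nat) (q : {poly int}) : (k%:R * q)`_n = k%:R * q`_n by rewrite mulr_natl coefMn mulr_natl.
rewrite !cE coef_eis_deriv.
(* The step (a - b, b) turns a^2 + ab + b^2 into a^2 - ab + b^2, and the difference of the squares
   is 4 ab (a^2 + b^2), the summand for sigma_1 against sigma_3. *)
pose h (a b : nat) : int := (a%:Z ^+ 2 + a%:Z * b%:Z + b%:Z ^+ 2) ^+ 2.
pose f (a b : nat) : int := 4 * (a%:Z ^+ 3 * b%:Z + a%:Z * b%:Z ^+ 3).
have hC a b : h a b = h b a by rewrite /h; ring.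
have fC a b : f a b = f b a by rewrite /f; ring.
have fh a b : (b < a)%N -> f a b = h a b - h (a - b)%N b.
  by move=> ab; rewrite /h /f -subzn ?(ltnW ab) //; ring.
have := convolution_identity nN hC fC fh.
have -> : \sum_(q <- sols N n) f q.1.1.1 q.1.1.2 = 8 * (eis 1 * eis 3)`_n.
  have e : (eis 3 * eis 1)`_n = (eis 1 * eis 3)`_n by rewrite mulrC.
  have -> : 8 * (eis 1 * eis 3)`_n = 4 * ((eis 3 * eis 1)`_n + (eis 1 * eis 3)`_n) by rewrite e; ring.
  by rewrite !coef_eisM -big_split mulr_sumr; apply: eq_bigr => q _; rewrite /f !expr1.
move/(congr1 (fun z => 30 * z)); rewrite mulrDr -!pairsZ.
set p1 := pairs _ _ _; set p2 := pairs _ _ _.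
(* On the diagonal f - h = - a^4, and a^4 m = n a^3. The remaining sums of a^4 cancel against those
   in p2. *)
have -> : p1 = 30 * pairs N n (fun a _ => a%:Z ^+ 4) - 30 * (n%:Z * (eis 3)`_n).
  rewrite coef_eis -!pairsZ -mulN1r -pairsZ -pairsD.
  by apply: eq_pairs => a m a0 m0 <-; rewrite /f /h PoszM; ring.
have -> : p2 = 21 * (eis 5)`_n + (-30) * pairs N n (fun a _ => a%:Z ^+ 4) + 10 * (eis 3)`_n + (-1) * (eis 1)`_n.
  rewrite !coef_eis -!pairsZ -!pairsD pairsC.
  by apply: eq_pairs => a m a0 m0 _; apply: etrans (power_sum4 m0) _; ring.
by move=> e; apply: etrans (etrans e _); ring.
Qed.

(* This is Ramanujan's identity 2 theta E6 = E2 E6 - E4^2. *)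
Lemma eis_conv15 : eqmX N.+1 (504 * (eis 1 * eis 5) - 2400 * (eis 3 * eis 3))
  (eis 1 + 21 * eis 5 + 20 * eis 3 - 42 * ('X * (eis 5)^`())).
Proof.
move=> n; rewrite ltnS => nN; rewrite !coefB !coefD.
have cE (k : nat) (q : {poly int}) : (k%:R * q)`_n = k%:R * q`_n by rewrite mulr_natl coefMn mulr_natl.
rewrite !cE coef_eis_deriv.
pose f (a b : nat) : int := 84 * (a%:Z ^+ 5 * b%:Z + a%:Z * b%:Z ^+ 5) - 800 * (a%:Z ^+ 3 * b%:Z ^+ 3).
pose h (a b : nat) : int := h6 a b.
have hC a b : h a b = h b a by rewrite /h /h6; ring.
have fC a b : f a b = f b a by rewrite /f; ring.
have fh a b : (b < a)%N -> f a b = h a b - h (a - b)%N b.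
  by move=> ab; rewrite /h /h6 /f -subzn ?(ltnW ab) //; ring.
have := convolution_identity nN hC fC fh.
have -> : \sum_(q <- sols N n) f q.1.1.1 q.1.1.2 = 168 * (eis 1 * eis 5)`_n - 800 * (eis 3 * eis 3)`_n.
  have e : (eis 5 * eis 1)`_n = (eis 1 * eis 5)`_n by rewrite mulrC.
  have -> : 168 * (eis 1 * eis 5)`_n = 84 * ((eis 5 * eis 1)`_n + (eis 1 * eis 5)`_n) by rewrite e; ring.
  by rewrite !coef_eisM -big_split !mulr_sumr -sumrB; apply: eq_bigr => q _; rewrite /f !expr1.
move/(congr1 (fun z => 6 * z)); cbv beta; rewrite [6 * (pairs _ _ _ + _)]mulrDr -!pairsZ.
set p1 := pairs _ _ _; set p2 := pairs _ _ _.
have -> : p1 = 84 * pairs N n (fun a _ => a%:Z ^+ 6) - 84 * (n%:Z * (eis 5)`_n).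
  rewrite coef_eis -!pairsZ -mulN1r -pairsZ -pairsD.
  by apply: eq_pairs => a m a0 m0 <-; rewrite /f /h /h6 PoszM; ring.
have -> : p2 = (-84) * pairs N n (fun a _ => a%:Z ^+ 6) + 42 * (eis 5)`_n + 40 * (eis 3)`_n + 2 * (eis 1)`_n.
  rewrite !coef_eis -!pairsZ -!pairsD pairsC.
  by apply: eq_pairs => a m a0 m0 _; apply: etrans (power_sum6 m0) _; ring.
by move=> e; apply: (@mulfI _ 2) => //; apply: etrans (etrans e _); ring.
Qed.

End Eisenstein.

(** * The discriminant modulo 5 *)

Lemma iota1S k : iota 1 k.+1 = iota 1 k ++ [:: k.+1].
Proof. by rewrite -[k.+1 in LHS]addn1 iotaD add1n. Qed.

(** Logarithmic differentiation one factor at a time: 1 - X^a contributes - a X^a / (1 - X^a), a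
    geometric series of which N terms suffice ([geo]). *)
Lemma euler_deriv N : eqmX N.+1 ('X * (euler int 1 N)^`()) (- eis N 1 * euler int 1 N).
Proof.
have geo a : (0 < a)%N ->
    eqmX N.+1 ((\sum_(m <- iota 1 N) 'X^(a * m)) * (1 - 'X^a)) ('X^a : {poly int}).
  move=> a0; have -> : (\sum_(m <- iota 1 N) 'X^(a * m)) * (1 - 'X^a) = 'X^a - 'X^(a * N.+1) :> {poly int}.
    elim: (N) => [|k IH]; first by rewrite big_nil muln1; ring.
    by rewrite iota1S big_cat big_seq1 mulrDl IH !mulnS !exprD; ring.
  rewrite -[X in eqmX _ _ X]subr0; apply: eqmXB => //.
  by apply: eqmX_Xn; nia.
pose S M : {poly int} := \sum_(a <- iota 1 M) a%:R * \sum_(m <- iota 1 N) 'X^(a * m).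
have -> : eis N 1 = S N.
  apply: eq_bigr => a _; rewrite mulr_sumr; apply: eq_bigr => m _.
  by rewrite expr1 -[a%:Z]natz scaler_nat mulr_natl.
suff main M : eqmX N.+1 ('X * (euler int 1 M)^`()) (- S M * euler int 1 M) by [].
elim: M => [|M /eqmXP[r IH]].
  by rewrite euler0 derivC /S big_nil => i _; rewrite !(mulr0, oppr0, mul0r).
have /eqmXP[s gE] := geo M.+1 isT.
rewrite euler1S derivM derivB derivC derivXn sub0r.
have -> : S M.+1 = S M + M.+1%:R * \sum_(m <- iota 1 N) 'X^(M.+1 * m).
  by rewrite /S iota1S big_cat big_seq1.
apply/eqmXP; exists (r * (1 - 'X^(M.+1)) + M.+1%:R * euler int 1 M * s).
move: gE IH; set g := \sum_(m <- _) _; set E := euler _ _ _ => gE IH.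
rewrite mulrDr [X in X + _]mulrA IH.
have -> : 'X * (E * - ('X^M *+ M.+1)) = - M.+1%:R * E * 'X^(M.+1) by rewrite exprS -mulr_natl; ring.
have e : g * (1 - 'X^(M.+1)) - 'X^(M.+1) - s * 'X^(N.+1) = 0 by rewrite gE; ring.
apply/eqP; rewrite -subr_eq0; apply/eqP.
by rewrite -[RHS](mulr0 (M.+1%:R * E)) -e; ring.
Qed.

(** Comparing coefficients gives (n - 1) Z_n = 0 once the lower ones vanish, so indices 0 and 1 have
    to be supplied. *)
Lemma eqmX_ode_unique N (e Z : {poly int}) : e`_0 = 1 -> Z`_0 = 0 -> Z`_1 = 0 ->
  eqmX N.+1 ('X * Z^`()) (e * Z) -> eqmX N.+1 Z 0.
Proof.
move=> e0 Z0 Z1 ode n; have [k] := ubnP n; elim: k n => // k IH n; rewrite ltnS => nk nN.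
rewrite coef0; case: n nk nN => [|[|n]] // nk nN.
have := ode _ nN; rewrite coefXM coef_deriv coefM big_ord_recl e0 mul1r subn0 /=.
rewrite big1 ?addr0; last first.
  by move=> j _; rewrite IH ?coef0 ?mulr0 //= /bump /=; have := ltn_ord j; lia.
rewrite mulrSr -[X in _ = X]add0r => /addIr/eqP.
by rewrite mulrn_eq0 => /eqP.
Qed.

(* Both sides solve theta Z = E2 Z, by [euler_deriv] and Ramanujan's identities. *)
Lemma delta_eisenstein N : (0 < N)%N ->
  eqmX N.+1 (1728 * ('X * euler int 1 N ^+ 24))
    ((1 + 240 * eis N 3) ^+ 3 - (1 - 504 * eis N 5) ^+ 2).
Proof.
move=> N0.
have /eqmXP[r1 I13] := @eis_conv13 N; have /eqmXP[r2 I15] := @eis_conv15 N.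
have /eqmXP[r3 ED] := @euler_deriv N.
have s0 i : (eis N i)`_0 = 0.
  rewrite coef_eis /pairs big_seq big1 // => a; rewrite mem_iota => /andP[a0 _].
  rewrite big_seq_cond big1 // => m; rewrite mem_iota muln_eq0.
  by case: a a0 => // a _ /andP[]; case: m.
have s1 i : (eis N i)`_1 = 1.
  rewrite coef_eis /pairs; case: N N0 {I13 I15 ED s0} => // M _.
  rewrite big_cons [X in X + _](_ : _ = 1); last first.
    rewrite big_cons /= big_seq_cond big1 ?addr0 ?expr1n // => m.
    by rewrite mem_iota mul1n; case: eqP => [->|]; rewrite ?andbF.
  rewrite big_seq big1 ?addr0 // => a; rewrite mem_iota => /andP[a1 _].
  rewrite big_seq_cond big1 // => m; rewrite mem_iota.
  by case: eqP; rewrite ?andbF //; nia.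
set S1 := eis N 1 in I13 I15 ED *; set S3 := eis N 3 in I13 I15 *; set S5 := eis N 5 in I13 I15 *.
set E := euler int 1 N in ED *.
set D := 'X * E ^+ 24; set Y := _ - _.
suff /eqmXP[r h] : eqmX N.+1 (1728 * D - Y) 0.
  by apply/eqmXP; exists r; rewrite -[LHS](subrK Y) h; ring.
have z0 (p q : {poly int}) : (p * q)`_0 = p`_0 * q`_0 by rewrite coefM big_ord1.
have z1 (p q : {poly int}) : (p * q)`_1 = p`_0 * q`_1 + p`_1 * q`_0.
  by rewrite coefM big_ord_recl big_ord1.
have cm k (q : {poly int}) n : (k%:R * q)`_n = k%:R * q`_n by rewrite mulr_natl coefMn mulr_natl.
have c0 k i : (1 + k%:R * eis N i)`_0 = 1 by rewrite coefD cm s0 mulr0 addr0 coef1.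
have c0N k i : (1 - k%:R * eis N i)`_0 = 1 by rewrite coefB cm s0 mulr0 subr0 coef1.
have c1 k i : (1 + k%:R * eis N i)`_1 = k%:R by rewrite coefD cm s1 mulr1 coef1 add0r.
have c1N k i : (1 - k%:R * eis N i)`_1 = - k%:R by rewrite coefB cm s1 mulr1 coef1 sub0r.
have p0 k (q : {poly int}) : q`_0 = 1 -> (q ^+ k)`_0 = 1.
  by move=> q0; elim: k => [|k IH]; rewrite ?expr0 ?coef1 // exprS z0 IH q0.
have p1 k (q : {poly int}) : q`_0 = 1 -> (q ^+ k)`_1 = k%:R * q`_1.
  move=> q0; elim: k => [|k IH]; first by rewrite expr0 coef1 mul0r.
  by rewrite exprS z1 IH p0 // q0 mulrSr; ring.
have E0 : (E ^+ 24)`_0 = 1 by rewrite p0 // euler_coef0.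
apply: (@eqmX_ode_unique _ (1 - 24 * S1)).
- exact: c0N.
- by rewrite coefB cm /D z0 coefX mul0r mulr0 /Y coefB !p0 ?c0 ?c0N // !subrr.
(* This is 1728 = 3 * 240 + 2 * 504. *)
- rewrite coefB cm /D z1 !coefX E0 mul0r add0r mulr1 /Y coefB !p1 ?c0 ?c0N // c1 c1N.
  by ring.
have h1 : 3 * ('X * (1 + 240 * S3)^`()) = (1 - 24 * S1) * (1 + 240 * S3) - (1 - 504 * S5) + 24 * r1 * 'X^(N.+1).
  have e : (240 * S3)^`() = 240 * S3^`() by rewrite !mulr_natl derivMn.
  rewrite derivD derivC add0r e; have := congr1 (fun z => 24 * z) I13; cbv beta => e'.
  apply/eqP; rewrite -subr_eq0; apply/eqP; move: e' => /eqP; rewrite -subr_eq0 => /eqP e'.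
  by rewrite -[RHS]e'; ring.
have h2 : 2 * ('X * (1 - 504 * S5)^`()) = (1 - 24 * S1) * (1 - 504 * S5) - (1 + 240 * S3) ^+ 2 - 24 * r2 * 'X^(N.+1).
  have e : (504 * S5)^`() = 504 * S5^`() by rewrite !mulr_natl derivMn.
  rewrite derivB derivC sub0r e; have := congr1 (fun z => 24 * z) I15; cbv beta => e'.
  apply/eqP; rewrite -subr_eq0; apply/eqP; move: e' => /eqP; rewrite -subr_eq0 => /eqP e'.
  by rewrite -[RHS]oppr0 -e'; ring.
rewrite derivB {1}/D /Y; set E4 := 1 + 240 * S3 in h1 h2 *; set E6 := 1 - 504 * S5 in h1 h2 *.
have -> : (1728 * ('X * E ^+ 24))^`() = 1728 * (E ^+ 24 + 'X * (24 * E ^+ 23 * E^`())).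
  rewrite [in LHS]mulr_natl derivMn derivM derivX mul1r deriv_exp.
  by rewrite -[LHS]mulr_natl -[_ *+ 24]mulr_natl /=; ring.
have -> : (E4 ^+ 3 - E6 ^+ 2)^`() = 3 * E4 ^+ 2 * E4^`() - 2 * E6 * E6^`().
  by rewrite derivB !deriv_exp /=; ring.
(* In E4^2 (E2 E4 - E6) - E6 (E2 E6 - E4^2) the terms E4^2 E6 cancel, leaving E2 (E4^3 - E6^2); the
   witness collects the truncation errors. *)
apply/eqmXP; exists (1728 * 24 * 'X * E ^+ 23 * r3 - 24 * E4 ^+ 2 * r1 - 24 * E6 * r2).
rewrite /D; have -> : 'X * (1728 * (E ^+ 24 + 'X * (24 * E ^+ 23 * E^`())) - (3 * E4 ^+ 2 * E4^`() - 2 * E6 * E6^`()))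
  = 1728 * 'X * (E ^+ 24 + 24 * E ^+ 23 * ('X * E^`())) - E4 ^+ 2 * (3 * ('X * E4^`())) + E6 * (2 * ('X * E6^`())) by ring.
rewrite h1 h2 ED; ring.
Qed.

Lemma eqmX_map (R S : comNzRingType) (f : {rmorphism R -> S}) N (p q : {poly R}) :
  eqmX N p q -> eqmX N (map_poly f p) (map_poly f q).
Proof. by move=> h i iN; rewrite !coef_map h. Qed.

Lemma map_euler (R S : comNzRingType) (f : {rmorphism R -> S}) k N :
  map_poly f (euler R k N) = euler S k N.
Proof.
rewrite /euler rmorph_prod; apply: eq_bigr => i _.
by rewrite rmorphB rmorph1 /= map_polyXn.
Qed.

Definition sigma (n : nat) : nat := \sum_(d <- divisors n) d.

Lemma pairs_sigma N n : (0 < n)%N -> (n <= N)%N ->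
  pairs N n (fun a _ => a%:Z ^+ 1) = (sigma n)%:Z.
Proof.
move=> n0 nN; rewrite /pairs /sigma -[RHS]natz natr_sum.
transitivity (\sum_(a <- iota 1 N | (a %| n)%N) (a%:R : int)).
  rewrite [RHS]big_mkcond; apply: eq_big_seq => a; rewrite mem_iota => /andP[a0 aN].
  case: ifP => [/dvdnP[m e]|an].
    have mN : m \in iota 1 N by rewrite mem_iota; move: n0 nN; rewrite e; nia.
    rewrite big_mkcond (bigD1_seq m) ?iota_uniq //= mulnC -e eqxx expr1 natz big1 ?addr0 // => j jm.
    by case: eqP => // ej; move: jm; rewrite -(eqn_pmul2l a0) ej e mulnC eqxx.
  by rewrite big1 // => m /eqP e; rewrite -e dvdn_mulr in an.
rewrite -[LHS]big_filter; apply: perm_big; apply: uniq_perm.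
- by rewrite filter_uniq ?iota_uniq.
- exact: divisors_uniq.
move=> d; rewrite mem_filter mem_iota -dvdn_divisors //.
by case: (boolP (d %| n)%N) => // dn; have := dvdn_leq n0 dn; have := dvdn_gt0 n0 dn; lia.
Qed.

(* Modulo 5, E4 = 1 and E6 = E2, whence 1728 Delta = 1 - E6^2 = - 2 theta E6. *)
Theorem tau_mod5 N n : (n < N)%N ->
  (euler 'F_5 1 N ^+ 24)`_n = (n.+1 * sigma n.+1)%:R.
Proof.
move=> nN; have nN1 : (n.+1 < N.+1)%N by [].
move e2 : (n.+1 * sigma n.+1)%N => c.
pose f : {rmorphism int -> 'F_5} := intr.
have cst k : k%:R = (k %% 5)%:R :> {poly 'F_5}.
  have F k' : (k'%:R : 'F_5) = (k' %% 5)%:R by apply/val_inj; rewrite /= !val_Fp_nat ?modn_mod.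
  by rewrite -!polyC_natr F.
have N0 : (0 < N)%N by case: (N) nN.
have := eqmX_map f (delta_eisenstein N0); have := eqmX_map f (@eis_conv15 N).
rewrite !(rmorph_nat, rmorph1, rmorphXn, rmorphM, rmorphB, rmorphD) /= map_polyX map_euler -deriv_map.
(* By Fermat a^5 = a in F_5. *)
have s5 : map_poly f (eis N 5) = map_poly f (eis N 1).
  apply/polyP => i; rewrite !coef_map !coef_eis /pairs !raddf_sum; apply: eq_bigr => a _.
  rewrite !raddf_sum; apply: eq_bigr => m _.
  rewrite expr1 -[LHS]/(f (a%:Z ^+ 5)) -[RHS]/(f a%:Z) rmorphXn.
  by have := expf_card (f a%:Z); rewrite card_Fp.
have e1 : ('X * (map_poly f (eis N 1))^`())`_n.+1 = c%:R.
  have -> : 'X * (map_poly f (eis N 1))^`() = map_poly f ('X * (eis N 1)^`()).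
    by rewrite rmorphM /= map_polyX deriv_map.
  by rewrite coef_map coef_eis_deriv coef_eis pairs_sigma // -PoszM e2 /= -pmulrn.
rewrite s5; move: (map_poly f (eis N 3)) (map_poly f (eis N 1)) e1 => s3 s e1.
rewrite [504]cst [2400]cst [21]cst [20]cst [42]cst [1728]cst [240]cst /=.
set D := 'X * _ ^+ 24; set T := 'X * s^`() in e1 *.
move=> h1 h2; have five : 5%:R = 0 :> {poly 'F_5} by rewrite [5%:R]cst.
have chr (p q r : {poly 'F_5}) : p = q + 5%:R * r -> p = q by rewrite five mul0r addr0.
have {}h1 : eqmX N.+1 (4%:R * (s * s) - 0 * (s3 * s3)) (s + 1 * s + 0 * s3 - 2%:R * T) := h1.
have {}h2 : eqmX N.+1 (3%:R * D) ((1 + 0 * s3) ^+ 3 - (1 - 4%:R * s) ^+ 2) := h2.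
have h3 : eqmX N.+1 (2 * T) (2 * s - 4 * s ^+ 2).
  have := eqmXB (@eqmX_refl _ N.+1 (s + s)) h1.
  rewrite (_ : _ - _ = 2 * s - 4 * s ^+ 2); last by ring.
  by rewrite [X in eqmX _ _ X](_ : _ = 2 * T); [apply: eqmX_sym|ring].
have : eqmX N.+1 D T.
  (* As 2 and 3 are inverse modulo 5, doubling h2 isolates D and tripling h3 isolates T; both right
     sides reduce to s - 2 s^2. *)
  rewrite [D](chr _ (2 * (3 * D)) (- D)); last by ring.
  rewrite [T](chr _ (3 * (2 * T)) (- T)); last by ring.
  apply: eqmX_trans (eqmXM (@eqmX_refl _ _ _) h2) _.
  apply: eqmX_trans (eqmX_sym (eqmXM (@eqmX_refl _ _ _) h3)).
  by rewrite [X in eqmX _ X](chr _ (3 * (2 * s - 4 * s ^+ 2)) (2 * s - 4 * s ^+ 2)) //; ring.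
move/(_ _ nN1); rewrite e1 /D coefXM => h; exact: h.
Qed.

(** * The divisor sum along powers of a prime *)

Definition sigma_coprime (p n : nat) : nat := \sum_(d <- divisors n | ~~ (p %| d)%N) d.

Lemma sigmaM_prime p m : prime p -> (0 < m)%N ->
  sigma (p * m) = (p * sigma m + sigma_coprime p (p * m))%N.
Proof.
move=> pp m0; have p0 := prime_gt0 pp; have pm0 : (0 < p * m)%N by rewrite muln_gt0 p0.
rewrite /sigma (bigID (fun d => p %| d)%N) /=; congr (_ + _)%N.
rewrite -[LHS]big_filter big_distrr /=.
apply: (big_seq_bij (f := fun d => (p * d)%N) (g := fun d => (d %/ p)%N)).
- exact: divisors_uniq.
- by rewrite filter_uniq ?divisors_uniq.
- move=> d; rewrite mem_filter -!dvdn_divisors // dvdn_mulr //=.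
  by rewrite dvdn_pmul2l.
- move=> d; rewrite mem_filter -!dvdn_divisors // => /andP[/dvdnP[k ->]].
  by rewrite mulnK // mulnC dvdn_pmul2l.
- by move=> d _; rewrite mulKn.
- by move=> d; rewrite mem_filter => /andP[pd _]; rewrite mulnC divnK.
Qed.

Lemma sigma_coprimeM p m : prime p -> (0 < m)%N ->
  sigma_coprime p (p * m) = sigma_coprime p m.
Proof.
move=> pp m0; have p0 := prime_gt0 pp; have pm0 : (0 < p * m)%N by rewrite muln_gt0 p0.
rewrite /sigma_coprime -[LHS]big_filter -[RHS]big_filter; apply: perm_big; apply: uniq_perm.
- by rewrite filter_uniq ?divisors_uniq.
- by rewrite filter_uniq ?divisors_uniq.
move=> d; rewrite !mem_filter -!dvdn_divisors //; case: (boolP (p %| d)%N) => //= pd.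
by rewrite Gauss_dvdr // coprime_sym prime_coprime.
Qed.

(** Both sigma(p^2 m) - p sigma(pm) and sigma(pm) - p sigma(m) are the sum of the divisors of m
    prime to p. *)
Lemma sigma_recurrence p m : prime p -> (0 < m)%N ->
  (sigma (p ^ 2 * m) + p * sigma m = p.+1 * sigma (p * m))%N.
Proof.
move=> pp m0; have pm0 : (0 < p * m)%N by rewrite muln_gt0 prime_gt0.
rewrite expnS expn1 -mulnA (sigmaM_prime pp pm0) sigma_coprimeM // (sigmaM_prime pp m0).
ring.
Qed.

Lemma sigma_prime p : prime p -> sigma p = p.+1.
Proof.
move=> pp; rewrite -[p in LHS]muln1 (sigmaM_prime pp) // sigma_coprimeM //.
rewrite /sigma /sigma_coprime (_ : divisors 1 = [:: 1]) //.
by rewrite big_seq1 big_cons big_nil dvdn1 gtn_eqF ?prime_gt1 // muln1 addn1.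
Qed.

Lemma Fp_nat_eq (p x y : nat) : prime p -> (x%:R = y%:R :> 'F_p) -> (x = y %[mod p])%N.
Proof. by move=> pp /(congr1 val); rewrite /= !val_Fp_nat. Qed.

Lemma nat_eq_Fp (p x y : nat) : prime p -> (x = y %[mod p])%N -> x%:R = y%:R :> 'F_p.
Proof. by move=> pp h; apply: val_inj; rewrite /= !val_Fp_nat. Qed.

(** Since sigma(p) = p + 1, the hypothesis forces p = -1 mod 5. The recurrence then reads sigma(p^2
    k) = sigma(k), and p^4 = p^2 = 1. *)
Lemma nsigma_p4_mod5 p m : prime p -> p <> 5 -> (0 < m)%N -> (p * sigma p = 0 %[mod 5])%N ->
  (p ^ 4 * m * sigma (p ^ 4 * m) = p ^ 2 * (m * sigma m) %[mod 5])%N.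
Proof.
move=> pp p5 m0 h; have c5 : coprime 5 p.
  by rewrite prime_coprime // dvdn_prime2 //; apply/eqP => e; apply: p5.
have {h} h : (5 %| p.+1)%N.
  by move: h => /eqP; rewrite mod0n -/(dvdn _ _) Gauss_dvdr // sigma_prime.
have F (x : nat) : (x%:R == 0 :> 'F_5) = (5 %| x)%N by rewrite (dvdn_pcharf (pchar_Fp _)).
apply: Fp_nat_eq => //; have pE : p%:R = -1 :> 'F_5.
  by apply/eqP; rewrite -subr_eq0 opprK natr1 F.
have rec k : (0 < k)%N -> (sigma (p ^ 2 * k))%:R = (sigma k)%:R :> 'F_5.
  move=> k0; have := congr1 (fun x => x%:R : 'F_5) (sigma_recurrence pp k0); cbv beta.
  rewrite natrD !natrM -[p.+1]addn1 natrD pE addNr mul0r mulN1r => /eqP.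
  by rewrite subr_eq0 => /eqP.
have -> : (p ^ 4 = p ^ 2 * p ^ 2)%N by rewrite -expnD.
have m0' : (0 < p ^ 2 * m)%N by rewrite muln_gt0 expn_gt0 prime_gt0.
by rewrite -[in sigma _]mulnA !natrM !rec // pE; ring.
Qed.

(** * Lipschitz quaternions *)

Notation quat R := (R * R * R * R)%type.

Section Quaternions.
Variable R : comNzRingType.
Implicit Types a b c : quat R.

Definition qmul a b : quat R :=
  let: (a0, a1, a2, a3) := a in let: (b0, b1, b2, b3) := b in
  (a0 * b0 - a1 * b1 - a2 * b2 - a3 * b3,
   a0 * b1 + a1 * b0 + a2 * b3 - a3 * b2,
   a0 * b2 - a1 * b3 + a2 * b0 + a3 * b1,
   a0 * b3 + a1 * b2 - a2 * b1 + a3 * b0).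

Definition qconj a : quat R :=
  let: (a0, a1, a2, a3) := a in (a0, - a1, - a2, - a3).

Definition qnorm a : R :=
  let: (a0, a1, a2, a3) := a in a0 ^+ 2 + a1 ^+ 2 + a2 ^+ 2 + a3 ^+ 2.

Definition qadd a b : quat R :=
  let: (a0, a1, a2, a3) := a in let: (b0, b1, b2, b3) := b in
  (a0 + b0, a1 + b1, a2 + b2, a3 + b3).

Definition qscal (n : R) a : quat R :=
  let: (a0, a1, a2, a3) := a in (n * a0, n * a1, n * a2, n * a3).

Definition qreal (n : R) : quat R := (n, 0, 0, 0).

Ltac quat_ring :=
  repeat (move=> [[[? ?] ?] ?]);
  rewrite /qmul /qconj /qnorm /qadd /qscal /qreal /=;
  try (congr (_, _, _, _)); ring.

Lemma qmulA : associative qmul. Proof. by quat_ring. Qed.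
Lemma qnormM a b : qnorm (qmul a b) = qnorm a * qnorm b.
Proof. by move: a b; quat_ring. Qed.
Lemma qnormC a : qnorm (qconj a) = qnorm a. Proof. by move: a; quat_ring. Qed.
Lemma qconjK : involutive qconj. Proof. by quat_ring. Qed.
Lemma qmulC a : qmul a (qconj a) = qreal (qnorm a). Proof. by move: a; quat_ring. Qed.
Lemma qCmul a : qmul (qconj a) a = qreal (qnorm a). Proof. by move: a; quat_ring. Qed.
Lemma qrealM n a : qmul (qreal n) a = qscal n a. Proof. by move: a; quat_ring. Qed.
Lemma qMreal n a : qmul a (qreal n) = qscal n a. Proof. by move: a; quat_ring. Qed.
Lemma qnorm_scal n a : qnorm (qscal n a) = n ^+ 2 * qnorm a.
Proof. by move: a; quat_ring. Qed.
Lemma qscalMl n a b : qmul (qscal n a) b = qscal n (qmul a b).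
Proof. by move: a b; quat_ring. Qed.
Lemma qscalMr n a b : qmul a (qscal n b) = qscal n (qmul a b).
Proof. by move: a b; quat_ring. Qed.
Lemma qscal1 a : qscal 1 a = a. Proof. by move: a; quat_ring. Qed.
Lemma qnorm_real n : qnorm (qreal n) = n ^+ 2. Proof. by rewrite /=; ring. Qed.
Lemma qmulDl a b c : qmul (qadd a b) c = qadd (qmul a c) (qmul b c).
Proof. by move: a b c; quat_ring. Qed.

End Quaternions.

Lemma qscalI (n : int) (a b : quat int) : n != 0 -> qscal n a = qscal n b -> a = b.
Proof.
move: a b => [[[a0 a1] a2] a3] [[[b0 b1] b2] b3] n0 [].
by do 4! move=> /(mulfI n0) ->.
Qed.

Lemma qnorm_ge0 (a : quat int) : 0 <= qnorm a.
Proof. by case: a => [[[? ?] ?] ?] /=; rewrite !addr_ge0 ?sqr_ge0. Qed.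

Lemma qnorm_eq0 (a : quat int) : qnorm a = 0 -> a = (0, 0, 0, 0).
Proof.
case: a => [[[a0 a1] a2] a3] /= h.
have := sqr_ge0 a0; have := sqr_ge0 a1; have := sqr_ge0 a2; have := sqr_ge0 a3.
move=> h3 h2 h1 h0.
have /eqP : a0 ^+ 2 = 0 by lia.
have /eqP : a1 ^+ 2 = 0 by lia.
have /eqP : a2 ^+ 2 = 0 by lia.
have /eqP : a3 ^+ 2 = 0 by lia.
by rewrite !sqrf_eq0 => /eqP-> /eqP-> /eqP-> /eqP->.
Qed.

Definition zbox (N : nat) : seq int := [seq k%:Z - N%:Z | k <- iota 0 (N.*2.+1)].

Lemma mem_zbox N x : (x \in zbox N) = (`|x| <= N%:Z).
Proof.
apply/mapP/idP => [[k]|h]; first by rewrite mem_iota => h ->; lia.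
by exists (absz (x + N%:Z)); rewrite ?mem_iota; lia.
Qed.

Lemma zbox_uniq N : uniq (zbox N).
Proof. by rewrite map_inj_uniq ?iota_uniq // => x y; lia. Qed.

Definition zgrid (K : nat) : seq (quat int) :=
  allpairs pair (allpairs pair (allpairs pair (zbox K) (zbox K)) (zbox K)) (zbox K).

Lemma zgrid_uniq K : uniq (zgrid K).
Proof. by rewrite /zgrid !uniq_pairs ?zbox_uniq. Qed.

Lemma mem_zgrid K (a b c d : int) :
  `|a| <= K%:Z -> `|b| <= K%:Z -> `|c| <= K%:Z -> `|d| <= K%:Z ->
  (a, b, c, d) \in zgrid K.
Proof. by move=> ha hb hc hd; rewrite /zgrid !mem_pairs !mem_zbox ha hb hc hd. Qed.

(** The box loses nothing, because |x| <= x^2 <= N for each coordinate. *)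
Definition quats (N : nat) : seq (quat int) := [seq q <- zgrid N | qnorm q == N%:Z].

Lemma quats_uniq N : uniq (quats N).
Proof. by rewrite filter_uniq ?zgrid_uniq. Qed.

Lemma sqr_bound (x : int) (N : nat) : x ^+ 2 <= N%:Z -> `|x| <= N%:Z.
Proof. by rewrite expr2; nia. Qed.

Lemma mem_quats N q : (q \in quats N) = (qnorm q == N%:Z).
Proof.
rewrite mem_filter; case: eqP => // h; rewrite andTb.
case: q h => [[[a b] c] d]; rewrite {1}/qnorm => h.
have ha := sqr_ge0 a; have hb := sqr_ge0 b; have hc := sqr_ge0 c; have hd := sqr_ge0 d.
by apply: mem_zgrid; apply: sqr_bound; lia.
Qed.

Definition qdvdz (n : int) (a : quat int) : bool :=
  let: (a0, a1, a2, a3) := a in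
  [&& (n %| a0)%Z, (n %| a1)%Z, (n %| a2)%Z & (n %| a3)%Z].

Lemma qdvdzP n a : reflect (exists b, a = qscal n b) (qdvdz n a).
Proof.
apply: (iffP idP) => [|[[[[b0 b1] b2] b3] ->]]; last first.
  by rewrite /= !dvdz_mulr.
case: a => [[[a0 a1] a2] a3] /and4P[].
move=> /dvdzP[b0 ->] /dvdzP[b1 ->] /dvdzP[b2 ->] /dvdzP[b3 ->].
by exists (b0, b1, b2, b3); rewrite /= ![n * _]mulrC.
Qed.

(** A decidable form of right divisibility: the quotient can only be a conj(b) / norm(b). *)
Definition rdvdq (b a : quat int) : bool := qdvdz (qnorm b) (qmul a (qconj b)).

Lemma rdvdqP b a : qnorm b != 0 -> reflect (exists c, a = qmul c b) (rdvdq b a).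
Proof.
move=> b0; apply: (iffP (qdvdzP _ _)) => [[c hc]|[c ->]]; exists c.
  apply: (qscalI b0); rewrite -qscalMl -hc -qmulA qCmul qMreal //.
by rewrite -qmulA qmulC qMreal.
Qed.

(** Oddness of N excludes a remainder of exactly N/2, so the bound is strict. *)
Lemma balanced_mod (c N : int) : 0 < N -> (N %% 2)%Z = 1 ->
  exists k, `|c - N * k| *+ 2 < N.
Proof.
move=> N0 odN; have := modz_ge0 c (lt0r_neq0 N0); have := ltz_pmod c N0.
have e := divz_eq c N; set r := (c %% N)%Z in e *; set k := (c %/ N)%Z in e *.
move=> r1 r2; case: (ltP (r *+ 2) N) => h.
  exists k; have -> : c - N * k = r by rewrite e; ring.
  by rewrite ger0_norm.
exists (k + 1); have -> : c - N * (k + 1) = r - N by rewrite e; ring.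
lia.
Qed.

(** For r > 0, (r - N)^2 + s is at most N^2 - 2r (N - 2r). The bound on s holds when r is the
    largest of four coordinates and s the sum of the other squares. *)
Lemma flip_coordinate (r s N : int) : r != 0 -> `|r| *+ 2 < N -> s <= 3 * r ^+ 2 ->
  exists e, (e = 1 \/ e = -1) /\ (r - N * e) ^+ 2 + s < N ^+ 2.
Proof.
move=> r0 rN sr; have [rp|rn] := ltP 0 r.
  exists 1; split; first by left.
  have : r * (N - r *+ 2) > 0 by apply: mulr_gt0; lia.
  by nia.
exists (-1); split; first by right.
have : (- r) * (N + r *+ 2) > 0 by apply: mulr_gt0; lia.
by nia.
Qed.

(* A remainder with coordinates below N/2 has norm below N^2; when its norm
   is even, moving its largest coordinate by N (odd) repairs the parity while
   keeping the norm below N^2. *)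
Lemma odd_remainder (c : quat int) (N : int) : 0 < N -> (N %% 2)%Z = 1 ->
  ~~ qdvdz N c ->
  exists q r, c = qadd (qscal N q) r /\ (qnorm r %% 2)%Z = 1 /\ qnorm r < N ^+ 2.
Proof.
move=> N0 oN.
have bal c' : exists k r, c' = N * k + r /\ `|r| *+ 2 < N.
  by have [k hk] := balanced_mod c' N0 oN; exists k, (c' - N * k); rewrite addrC subrK.
have sq (r : int) : `|r| *+ 2 < N -> 4 * r ^+ 2 < N ^+ 2.
  by move=> h; rewrite -[r ^+ 2]real_normK ?num_real //; nia.
have sqne (r : int) : 0 < r ^+ 2 -> r != 0 by case: eqP => // ->.
have oN2 : ((N ^+ 2)%R %% 2)%Z = 1.
  have -> : (N ^+ 2 = ((N %/ 2)%Z ^+ 2 *+ 2 + (N %/ 2)%Z * 2) * 2 + 1)%R.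
    by rewrite {1}(divz_eq N 2) oN; ring.
  by rewrite modzMDl.
have step (r s : int) : r != 0 -> `|r| *+ 2 < N -> 0 <= s -> s <= 3 * r ^+ 2 ->
    ((r ^+ 2 + s)%R %% 2)%Z != 1 ->
    exists e, (((r - N * e) ^+ 2 + s)%R %% 2)%Z = 1 /\ (r - N * e) ^+ 2 + s < N ^+ 2.
  move=> r0 rN s0 sr ev; have [e [he lt]] := flip_coordinate r0 rN sr.
  exists e; split => //.
  have -> : (r - N * e) ^+ 2 + s = (N ^+ 2 * (e ^+ 2 - 1) + (r ^+ 2 + s) + N ^+ 2) + (- (r * N * e)) * 2.
    by ring.
  have -> : e ^+ 2 - 1 = 0 by case: he => ->.
  rewrite mulr0 add0r -modzDm modzMl addr0 modz_mod -modzDm oN2.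
  move: ev; have := ltz_pmod (r ^+ 2 + s) (isT : 0 < 2 :> int).
  have := modz_ge0 (r ^+ 2 + s) (isT : 2 != 0 :> int).
  by case: modz => // -[|[|]].
case: c => [[[c0 c1] c2] c3] ndv.
have [k0 [r0 [e0 h0]]] := bal c0; have [k1 [r1 [e1 h1]]] := bal c1.
have [k2 [r2 [e2 h2]]] := bal c2; have [k3 [r3 [e3 h3]]] := bal c3.
have fin f0 f1 f2 f3 : let r := (r0 - N * f0, r1 - N * f1, r2 - N * f2, r3 - N * f3) in
    (qnorm r %% 2)%Z = 1 -> qnorm r < N ^+ 2 ->
    exists q r, (c0, c1, c2, c3) = qadd (qscal N q) r /\ (qnorm r %% 2)%Z = 1 /\ qnorm r < N ^+ 2.
  move=> r o l; exists (k0 + f0, k1 + f1, k2 + f2, k3 + f3), r; split; last by [].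
  by rewrite e0 e1 e2 e3 /=; congr (_, _, _, _); ring.
have p0 := sqr_ge0 r0; have p1 := sqr_ge0 r1.
have p2 := sqr_ge0 r2; have p3 := sqr_ge0 r3.
have [od|ev] := eqVneq ((r0 ^+ 2 + r1 ^+ 2 + r2 ^+ 2 + r3 ^+ 2)%R %% 2)%Z 1.
  have s0 := sq _ h0; have s1 := sq _ h1; have s2 := sq _ h2; have s3 := sq _ h3.
  apply: (fin 0 0 0 0); rewrite /= !mulr0 !subr0 //.
  by clear -s0 s1 s2 s3; lia.
have pos : 0 < r0 ^+ 2 + r1 ^+ 2 + r2 ^+ 2 + r3 ^+ 2.
  rewrite lt_def !addr_ge0 // andbT; apply: contra ndv => /eqP z.
  have [z0 z1 z2 z3] := qnorm_eq0 (z : qnorm (r0, r1, r2, r3) = 0).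
  by rewrite /= e0 e1 e2 e3 z0 z1 z2 z3 !addr0 !dvdz_mulr.
have : (r1 ^+ 2 + r2 ^+ 2 + r3 ^+ 2 <= 3 * r0 ^+ 2) \/
       (r0 ^+ 2 + r2 ^+ 2 + r3 ^+ 2 <= 3 * r1 ^+ 2) \/
       (r0 ^+ 2 + r1 ^+ 2 + r3 ^+ 2 <= 3 * r2 ^+ 2) \/
       (r0 ^+ 2 + r1 ^+ 2 + r2 ^+ 2 <= 3 * r3 ^+ 2) by clear; lia.
have main r s : 0 <= s -> r ^+ 2 + s = r0 ^+ 2 + r1 ^+ 2 + r2 ^+ 2 + r3 ^+ 2 ->
    `|r| *+ 2 < N -> s <= 3 * r ^+ 2 ->
    exists e, (((r - N * e) ^+ 2 + s)%R %% 2)%Z = 1 /\ (r - N * e) ^+ 2 + s < N ^+ 2.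
  move=> s0 rs h sr; apply: step => //; last by rewrite rs.
  by apply: sqne; clear -sr rs pos s0; lia.
case=> [mx|[mx|[mx|mx]]].
- have [e [o l]] := main r0 (r1 ^+ 2 + r2 ^+ 2 + r3 ^+ 2) ltac:(by rewrite ?addr_ge0) ltac:(ring) h0 mx.
  apply: (fin e 0 0 0); rewrite /= !mulr0 !subr0; [rewrite -[RHS]o|move: l].
    by congr (modz _ _); ring.
  by congr is_true; congr (_ < _); ring.
- have [e [o l]] := main r1 (r0 ^+ 2 + r2 ^+ 2 + r3 ^+ 2) ltac:(by rewrite ?addr_ge0) ltac:(ring) h1 mx.
  apply: (fin 0 e 0 0); rewrite /= !mulr0 !subr0; [rewrite -[RHS]o|move: l].
    by congr (modz _ _); ring.
  by congr is_true; congr (_ < _); ring.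
- have [e [o l]] := main r2 (r0 ^+ 2 + r1 ^+ 2 + r3 ^+ 2) ltac:(by rewrite ?addr_ge0) ltac:(ring) h2 mx.
  apply: (fin 0 0 e 0); rewrite /= !mulr0 !subr0; [rewrite -[RHS]o|move: l].
    by congr (modz _ _); ring.
  by congr is_true; congr (_ < _); ring.
- have [e [o l]] := main r3 (r0 ^+ 2 + r1 ^+ 2 + r2 ^+ 2) ltac:(by rewrite ?addr_ge0) ltac:(ring) h3 mx.
  apply: (fin 0 0 0 e); rewrite /= !mulr0 !subr0; [rewrite -[RHS]o|move: l].
    by congr (modz _ _); ring.
  by congr is_true; congr (_ < _); ring.
Qed.

Lemma qmul1l (R : comNzRingType) (a : quat R) : qmul (qreal 1) a = a.
Proof. by rewrite qrealM qscal1. Qed.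

Lemma qmulCK (R : comNzRingType) (a b : quat R) :
  qmul (qconj a) (qmul a b) = qscal (qnorm a) b.
Proof. by rewrite qmulA qCmul qrealM. Qed.

(** Euclid's algorithm on the left combinations of x and y. Dividing by d works when its norm is
    odd, and [odd_remainder] keeps the norm odd, so the descent ends at a common right divisor. *)
Lemma odd_bezout (x y : quat int) : (qnorm y %% 2)%Z = 1 ->
  exists d, [/\ exists u v, d = qadd (qmul u x) (qmul v y),
    (qnorm d %% 2)%Z = 1, rdvdq d x & rdvdq d y].
Proof.
move=> oy.
pose comb d := exists u v, d = qadd (qmul u x) (qmul v y).
have combx : comb x.
  exists (qreal 1), (qreal 0); rewrite !qrealM.
  by clear oy comb; move: x y => [[[? ?] ?] ?] [[[? ?] ?] ?]; rewrite /=; congr (_, _, _, _); ring.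
have comby : comb y.
  exists (qreal 0), (qreal 1); rewrite !qrealM.
  by clear oy comb combx; move: x y => [[[? ?] ?] ?] [[[? ?] ?] ?]; rewrite /=; congr (_, _, _, _); ring.
have combS z d q : comb z -> comb d -> comb (qadd z (qmul (qscal (-1) q) d)).
  move=> [u1 [v1 ->]] [u [v ->]].
  exists (qadd u1 (qscal (-1) (qmul q u))), (qadd v1 (qscal (-1) (qmul q v))).
  clear oy comb combx comby; move: x y u v u1 v1 q.
  move=> [[[? ?] ?] ?] [[[? ?] ?] ?] [[[? ?] ?] ?] [[[? ?] ?] ?].
  move=> [[[? ?] ?] ?] [[[? ?] ?] ?] [[[? ?] ?] ?].
  by rewrite /qmul /qadd /qscal /=; congr (_, _, _, _); ring.
suff main n d : (absz (qnorm d) < n)%N -> comb d -> (qnorm d %% 2)%Z = 1 ->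
    exists d, [/\ comb d, (qnorm d %% 2)%Z = 1, rdvdq d x & rdvdq d y].
  exact: (main _ y (leqnn _)).
elim: n d => // n IH d; rewrite ltnS => dn cd od.
have d0 : 0 < qnorm d.
  by rewrite lt_def qnorm_ge0 andbT; case: eqP od => // ->.
have red z : comb z -> ~~ rdvdq d z ->
    exists d, [/\ comb d, (qnorm d %% 2)%Z = 1, rdvdq d x & rdvdq d y].
  move=> cz /(odd_remainder d0 od)[q [r [e [or rlt]]]].
  (* Dividing z conj(d) by norm(d) leaves r = s conj(d), whose norm is below norm(d)^2; hence s has
     smaller norm than d. *)
  set s := qadd z (qmul (qscal (-1) q) d).
  have sr : qmul s (qconj d) = r.
    rewrite qmulDl e -qmulA qmulC qMreal.
    by move: (q) (r) => [[[? ?] ?] ?] [[[? ?] ?] ?]; rewrite /=; congr (_, _, _, _); ring.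
  have ns : qnorm r = qnorm s * qnorm d by rewrite -sr qnormM qnormC.
  have slt : qnorm s < qnorm d by rewrite -(ltr_pM2r d0) -ns -expr2.
  apply: (IH s); last 1 first.
  - have := qnorm_ge0 s; move: or; rewrite ns -modzMm od mulr1 modz_mod => ->; done.
  - by have := qnorm_ge0 s; lia.
  - exact: combS.
have [dx|] := boolP (rdvdq d x); last exact: red.
have [dy|] := boolP (rdvdq d y); last exact: red.
by exists d.
Qed.

Lemma size_quats1 : size (quats 1) = 8%N.
Proof. by vm_compute. Qed.

Lemma prime_factor (p : nat) (a b : int) : prime p -> 0 <= a -> 0 <= b ->
  p%:Z = a * b -> a = 1 \/ b = 1.
Proof.
move=> pp; case: a => // a _; case: b => // b _; rewrite -PoszM => -[e].
have : (a %| p)%N by rewrite e dvdn_mulr.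
case/primeP: pp => p1 h /h /orP[/eqP->|/eqP ap]; first by left.
right; move: e; rewrite ap => e; congr Posz.
have : (p * b = p * 1)%N by rewrite muln1.
by move/eqP; rewrite eqn_pmul2l ?(ltnW p1) // => /eqP.
Qed.

Lemma dvdz_qnormD (p : int) (a b : quat int) :
  (p %| qnorm a)%Z -> (p %| qnorm (qadd a (qmul b (qreal p))))%Z.
Proof.
move: a b => [[[a0 a1] a2] a3] [[[b0 b1] b2] b3] h.
suff -> : qnorm (qadd (a0, a1, a2, a3) (qmul (b0, b1, b2, b3) (qreal p)))
  = qnorm (a0, a1, a2, a3) + p * (2 * a0 * b0 + 2 * a1 * b1 + 2 * a2 * b2 + 2 * a3 * b3
     + p * qnorm (b0, b1, b2, b3)).
  by rewrite rpredD ?dvdz_mulr.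
by rewrite /qnorm /qadd /qmul /qreal /=; ring.
Qed.

(* A generator d of the left ideal spanned by g and p has norm p, and the elements
   of norm p dividing g on the right are its left multiples by the 8 units. *)
Lemma primitive_rdvd_count (p : nat) (g : quat int) : prime p -> odd p ->
  (p%:Z %| qnorm g)%Z -> ~~ qdvdz p%:Z g ->
  count (fun b => rdvdq b g) (quats p) = 8%N.
Proof.
move=> pp op pg npg; have p0 : (p%:Z != 0) by have := prime_gt0 pp; lia.
have op2 : (qnorm (qreal p%:Z) %% 2)%Z = 1.
  by rewrite qnorm_real expr2 -modzMm (_ : (p%:Z %% 2)%Z = 1) //; lia.
have [d [[u [v dE]] od dg dp]] := odd_bezout g op2.
have d0 : qnorm d != 0 by case: eqP od => // ->.
have pd : (p%:Z %| qnorm d)%Z.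
  by rewrite dE; apply: dvdz_qnormD; rewrite qnormM dvdz_mull.
have [g' gE] := rdvdqP g d0 dg; have [p' pE] := rdvdqP _ d0 dp.
have nd : qnorm d = p%:Z.
  have [k kE] := dvdzP pd.
  have e : p%:Z = qnorm p' * k.
    apply: (mulfI p0); rewrite -expr2 -qnorm_real pE qnormM kE; ring.
  have k0 : 0 <= k.
    have := qnorm_ge0 d; rewrite kE pmulr_lge0 //.
    by have := prime_gt0 pp; lia.
  case: (prime_factor pp (qnorm_ge0 p') k0 e) => h; last by rewrite kE h mul1r.
  (* Here p' is a unit, so d = conj(p') p and p would divide g. *)
  case/negP: npg; apply/qdvdzP; exists (qmul g' (qconj p')).
  have -> : g = qmul g' d by [].
  rewrite -qscalMr; congr qmul.
  by rewrite -qMreal pE qmulCK h qscal1.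
rewrite -size_filter -size_quats1 -(size_map (fun u => qmul u d) (quats 1)).
apply: perm_size; apply: uniq_perm.
- by rewrite filter_uniq ?quats_uniq.
- rewrite map_inj_in_uniq ?quats_uniq // => a b _ _ e.
  apply: (qscalI d0); rewrite -!qMreal -qmulC !qmulA; congr (qmul _ _).
  exact: e.
move=> b; rewrite mem_filter mem_quats; apply/idP/mapP.
  case/andP=> bg /eqP nb; have b0 : qnorm b != 0 by rewrite nb.
  (* b right-divides both g and p = conj(b) b, hence their combination d. *)
  have : rdvdq b d.
    apply/rdvdqP => //; have [h hE] := rdvdqP g b0 bg.
    exists (qadd (qmul u h) (qmul v (qconj b))).
    by rewrite dE hE -nb -qCmul qmulDl !qmulA.
  case/(rdvdqP _ b0) => c cE.
  have nc : qnorm c = 1.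
    by apply: (mulIf p0); rewrite mul1r -{2}nd cE qnormM nb.
  exists (qconj c); first by rewrite mem_quats qnormC nc.
  by rewrite cE qmulCK nc qscal1.
case=> c; rewrite mem_quats => /eqP nc ->; rewrite qnormM nc mul1r nd eqxx andbT.
apply/rdvdqP; first by rewrite qnormM nc mul1r.
exists (qmul g' (qconj c)).
by rewrite -qmulA qmulCK nc qscal1.
Qed.

(** * The number of quaternions of prime norm *)

Lemma intr_Fp_eq0 (p : nat) (n : int) : prime p ->
  (n%:~R == 0 :> 'F_p) = (p%:Z %| n)%Z.
Proof.
move=> pp; have ch := pchar_Fp pp.
have nat_case m : (m%:R == 0 :> 'F_p) = (p %| m)%N by rewrite (dvdn_pcharf ch).
case: n => m; first by rewrite -pmulrn nat_case.
by rewrite NegzE mulrNz oppr_eq0 rpredN nat_case.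
Qed.

(** Pigeonhole: the squares and their images under x |-> -1 - x are two sets of (p + 1)/2 elements
    each in a field of p elements. *)
Lemma sum_two_squares_Fp (p : nat) : prime p -> odd p ->
  exists s t : 'F_p, s ^+ 2 + t ^+ 2 = -1.
Proof.
move=> pp op; have ch := pchar_Fp pp.
pose f (i : 'I_(p.+1)./2) : 'F_p := (nat_of_ord i)%:R ^+ 2.
have natF (m : nat) : (m%:R == 0 :> 'F_p) = (p %| m)%N by rewrite (dvdn_pcharf ch).
have f_inj : injective f.
  move=> i j /eqP; rewrite /f -subr_eq0 subr_sqr mulf_eq0.
  wlog ij : i j / (i <= j)%N => [hw|].
    case/orP: (leq_total i j) => h; first exact: hw.
    move=> e; apply/esym/hw => //.
    by rewrite -opprB oppr_eq0 [X in _ || (X == 0)]addrC.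
  rewrite -opprB oppr_eq0 -natrB // -natrD !natF => h; apply: ord_inj.
  have hi := ltn_ord i; have hj := ltn_ord j; have p1 := prime_gt1 pp.
  have := odd_double_half p.+1; rewrite -addnn /= op /= add0n => pE.
  have small m : (m < p)%N -> (p %| m)%N -> m = 0%N.
    by case: m => // m mp /dvdn_leq => /(_ isT); rewrite leqNgt mp.
  have hi2 : (i.+1 + i.+1 <= p.+1)%N by rewrite -[leqRHS]pE leq_add.
  have hj2 : (j.+1 + j.+1 <= p.+1)%N by rewrite -[leqRHS]pE leq_add.
  case/orP: h => /small hs; [have := hs ltac:(lia)|have := hs ltac:(lia)]; move: (nat_of_ord i) (nat_of_ord j) ij; clear; lia.
pose A := [set f i | i : 'I_(p.+1)./2]; pose B := [set -1 - f i | i : 'I_(p.+1)./2].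
have cA : #|A| = (p.+1)./2 by rewrite card_imset // card_ord.
have cB : #|B| = (p.+1)./2.
  by rewrite card_imset ?card_ord // => i j /addrI/oppr_inj/f_inj.
have : (0 < #|A :&: B|)%N.
  have := cardsUI A B; have : (#|A :|: B| <= p)%N.
    by rewrite -[leqRHS](card_Fp pp) max_card.
  rewrite cA cB; have pE := odd_double_half p.+1; move: pE; rewrite -addnn /= op /=; lia.
case/card_gt0P => x /setIP[/imsetP[i _ ->] /imsetP[j _ e]].
by exists (i%:R), (j%:R); move: e; rewrite /f => ->; ring.
Qed.

(** * Counting singular 2 by 2 matrices over F_p *)

Section CountNorm.
Variable p : nat.
Hypotheses (pp : prime p) (op : odd p).
Local Notation F := 'F_p.

Lemma two_neq0 : (2%:R : F) != 0.
Proof.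
rewrite -(dvdn_pcharf (pchar_Fp pp)); apply/negP => /dvdn_leq => /(_ isT).
by move: pp op; case: p => [|[|[|]]].
Qed.

Lemma card_singular_mx2 :
  #|[set A : 'M[F]_2 | (A != 0) && (\det A == 0)]| = ((p ^ 2 - 1) * (p + 1))%N.
Proof.
have cF : #|F| = p := card_Fp pp.
have cM : #|{: 'M[F]_2}| = (p ^ 4)%N by rewrite card_mx cF.
have cU : #|[set A : 'M[F]_2 | A \in unitmx]| = (p * p.-1 ^ 2 * p.+1)%N.
  transitivity #|'GL_2[F]%g|; last by rewrite card_GL_2 cF.
  by rewrite /GLgroup /= cardsT card_sub cardsE.
set S := [set A | _].
have : (#|S| + #|[set A : 'M[F]_2 | A \in unitmx]| + 1 = p ^ 4)%N.
  rewrite -cM -cardsT [RHS](cardsD1 0) inE addnC; congr (_ + _)%N.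
  rewrite -cardsUI (_ : S :&: _ = set0) ?cards0 ?addn0; last first.
    by apply/setP => A; rewrite !inE unitmxE unitfE; case: (\det A == 0); rewrite ?andbF.
  apply: eq_card => A; rewrite !inE unitmxE unitfE andbT.
  by case: (eqVneq A 0) => [->|_] /=; [rewrite det0 eqxx|case: eqP].
rewrite cU; move: #|S| (prime_gt0 pp) => s; case: (p) => // k _ /=.
move=> h; apply: (@addIn (k.+1 * k ^ 2 * k.+2 + 1)%N); rewrite addnA {}h.
have -> : (k.+1 ^ 2 - 1 = k * k.+2)%N by rewrite subn1 expnS expn1 mulSn /= -mulnS.
ring.
Qed.

(** B has rank 1, so each row of A ranges over a line, the left kernel of B. *)
Lemma card_annihilated_mx2 (B : 'M[F]_2) : B != 0 -> \det B = 0 ->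
  #|[set A : 'M[F]_2 | (A != 0) && (A *m B == 0)]| = (p ^ 2 - 1)%N.
Proof.
move=> B0 dB; have rB : \rank B = 1%N.
  have : (0 < \rank B)%N by rewrite lt0n mxrank_eq0.
  have : ~~ row_full B by rewrite row_full_unit unitmxE dB unitr0.
  rewrite /row_full; have := rank_leq_col B; lia.
pose K := rowg (kermx B).
have cK : #|K| = p by rewrite card_rowg mxrank_ker rB (card_Fp pp).
pose f (A : 'M[F]_2) := (row 0 A, row 1 A).
have f_inj : injective f.
  move=> A C [e0 e1]; apply/row_matrixP => i.
  by case: (fintype.splitP (i : 'I_(1 + 1))) => j; rewrite ord1 => h;
    [have -> : i = 0|have -> : i = 1]; try exact/val_inj.
have eA : f @: [set A : 'M[F]_2 | A *m B == 0] = setX K K.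
  apply/setP => -[u v]; rewrite inE /= !mem_rowg; apply/imsetP/andP.
    case=> A; rewrite inE => /eqP AB [-> ->].
    by split; apply/sub_kermxP; rewrite -row_mul AB row0.
  case=> /sub_kermxP uB /sub_kermxP vB.
  exists (\matrix_(i < 2) if i == 0 then u else v); last first.
    by rewrite /f !rowK.
  rewrite inE; apply/eqP/row_matrixP => i; rewrite row_mul rowK row0.
  by case: ifP.
have : #|[set A : 'M[F]_2 | A *m B == 0]| = (p ^ 2)%N.
  by rewrite -(card_imset _ f_inj) eA cardsX cK.
rewrite (cardsD1 0) inE mul0mx eqxx => <-; rewrite addnC addnK.
by apply: eq_card => A; rewrite !inE.
Qed.

End CountNorm.

(** * Splitting the quaternions into 2 by 2 matrices *)

Section Splitting.
Variables (F : fieldType) (s t : F).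
Hypotheses (st : s ^+ 2 + t ^+ 2 = -1) (two : 2%:R != 0 :> F).

(** By rows, i goes to (0, -1; 1, 0), j to (s, t; t, -s), whose square is s^2 + t^2 = -1, and k to
    their product. *)
Definition qmx (a : quat F) : 'M[F]_2 :=
  let: (x, y, z, w) := a in
  \matrix_(i < 2, j < 2)
    if i == 0 then (if j == 0 then x + z * s - w * t else - y + z * t + w * s)
    else (if j == 0 then y + z * t + w * s else x - z * s + w * t).

Definition mxq (A : 'M[F]_2) : quat F :=
  let a := A 0 0 in let b := A 0 1 in let c := A 1 0 in let d := A 1 1 in
  ((a + d) / 2%:R, (c - b) / 2%:R,
   - ((a - d) * s + (b + c) * t) / 2%:R, ((a - d) * t - (b + c) * s) / 2%:R).

Lemma ord2 (i : 'I_2) : i = 0 \/ i = 1.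
Proof. by case: i => [[|[|]]] // ?; [left|right]; apply: val_inj. Qed.

Lemma qmxK : cancel qmx mxq.
Proof.
move=> [[[x y] z] w]; rewrite /mxq !mxE /=.
have t2 : t ^+ 2 = -1 - s ^+ 2 by rewrite -st; ring.
by congr (_, _, _, _); field: t2.
Qed.

Lemma mxqK : cancel mxq qmx.
Proof.
move=> A; apply/matrixP => i j; rewrite /mxq /qmx mxE.
have t2 : t ^+ 2 = -1 - s ^+ 2 by rewrite -st; ring.
by case: (ord2 i) => ->; case: (ord2 j) => -> /=; field: t2.
Qed.

Lemma det_qmx a : \det (qmx a) = qnorm a.
Proof.
case: a => [[[x y] z] w]; rewrite (expand_det_row _ 0) !big_ord_recl big_ord0.
rewrite /cofactor !det_mx11 !mxE /= /bump /=.
have t2 : t ^+ 2 = -1 - s ^+ 2 by rewrite -st; ring.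
ring: t2.
Qed.

Lemma qmxM a b : qmx (qmul a b) = qmx a *m qmx b.
Proof.
move: a b => [[[x y] z] w] [[[x' y'] z'] w']; apply/matrixP => i j.
rewrite [RHS]mxE !big_ord_recl big_ord0 addr0 !mxE.
have t2 : t ^+ 2 = -1 - s ^+ 2 by rewrite -st; ring.
by case: (ord2 i) => ->; case: (ord2 j) => -> /=; ring: t2.
Qed.

End Splitting.

Lemma qnorm_conj_eq0 (F : fieldType) (a b : quat F) : b != qreal 0 ->
  qmul a (qconj b) == qreal 0 -> qnorm a = 0.
Proof.
move=> b0 /eqP /(congr1 (qmul (qconj a))); rewrite qmulCK qMreal => h.
apply/eqP; apply: contraNT b0 => a0.
have inj (x y : F) : qnorm a * x = 0 * y -> x = 0.
  by rewrite mul0r => /eqP; rewrite mulf_eq0 (negPf a0) => /eqP.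
have injN (x y : F) : qnorm a * - x = 0 * y -> x = 0.
  by move=> /inj/(canRL (@opprK _)); rewrite oppr0.
case: b (qconj a) h => [[[x y] z] w] [[[x' y'] z'] w'] [hx hy hz hw].
by rewrite (inj _ _ hx) (injN _ _ hy) (injN _ _ hz) (injN _ _ hw).
Qed.

Section CountPrimeNorm.
Variable p : nat.
Hypotheses (pp : prime p) (op : odd p).
Local Notation F := 'F_p.

Definition qred (a : quat int) : quat F :=
  let: (x, y, z, w) := a in (x%:~R, y%:~R, z%:~R, w%:~R).

Definition qlift (a : quat F) : quat int :=
  let: (x, y, z, w) := a in
  ((x : nat)%:Z, (y : nat)%:Z, (z : nat)%:Z, (w : nat)%:Z).

Lemma qliftK : cancel qlift qred.
Proof.
by move=> [[[x y] z] w]; rewrite /qred /qlift /=; congr (_, _, _, _); exact: natr_Zp.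
Qed.

Lemma qredM a b : qred (qmul a b) = qmul (qred a) (qred b).
Proof.
move: a b => [[[? ?] ?] ?] [[[? ?] ?] ?] /=.
by rewrite !(rmorphD, rmorphN, rmorphM).
Qed.

Lemma qredC a : qred (qconj a) = qconj (qred a).
Proof. by case: a => [[[? ?] ?] ?] /=; rewrite !rmorphN. Qed.

Lemma qnorm_red a : qnorm (qred a) = (qnorm a)%:~R.
Proof. by case: a => [[[? ?] ?] ?] /=; rewrite !(rmorphD, rmorphXn). Qed.

Lemma qred_eq0 a : (qred a == qreal 0) = qdvdz p%:Z a.
Proof.
case: a => [[[x y] z] w]; rewrite /qred /qdvdz -!(intr_Fp_eq0 _ pp).
by rewrite !xpair_eqE -!andbA.
Qed.

Lemma card_null_quat :
  #|[set a : quat F | (a != qreal 0) && (qnorm a == 0)]| = ((p ^ 2 - 1) * (p + 1))%N.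
Proof.
have [s [t st]] := sum_two_squares_Fp pp op; have two := two_neq0 pp op.
rewrite -card_singular_mx2 //.
have bij : bijective (qmx s t) := Bijective (qmxK st two) (mxqK st two).
have q0 : qmx s t (qreal 0) = 0.
  by apply/matrixP => i j; rewrite !mxE !(mul0r, oppr0, subr0, addr0); do !case: ifP.
rewrite -(on_card_preimset (onW_bij _ bij)); apply: eq_card => a.
by rewrite !inE (det_qmx st) -q0 (bij_eq bij).
Qed.

Lemma card_annihilated_quat (b : quat F) : b != qreal 0 -> qnorm b = 0 ->
  #|[set a : quat F | (a != qreal 0) && (qmul a b == qreal 0)]| = (p ^ 2 - 1)%N.
Proof.
have [s [t st]] := sum_two_squares_Fp pp op; have two := two_neq0 pp op.
have bij : bijective (qmx s t) := Bijective (qmxK st two) (mxqK st two).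
have q0 : qmx s t (qreal 0) = 0.
  by apply/matrixP => i j; rewrite !mxE !(mul0r, oppr0, subr0, addr0); do !case: ifP.
rewrite -(bij_eq bij) q0 -(det_qmx st) => b0 db.
rewrite -(card_annihilated_mx2 pp op b0 db).
rewrite -(on_card_preimset (onW_bij _ bij)); apply: eq_card => a.
by rewrite !inE -(qmxM st) -q0 !(bij_eq bij).
Qed.

Lemma qnormC_eq0 (b : quat F) : (qconj b == qreal 0) = (b == qreal 0).
Proof. by case: b => [[[? ?] ?] ?]; rewrite /= !xpair_eqE !oppr_eq0. Qed.

(* Count in two ways the pairs (b, a) with b of norm p and a a nonzero null
   quaternion mod p annihilated by the conjugate of b: each b has p^2 - 1 such a,
   each of the (p^2 - 1)(p + 1) null a has 8 such b. *)
Lemma size_quats_prime : size (quats p) = (8 * p.+1)%N.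
Proof.
have p0 : (p%:Z != 0) by have := prime_gt0 pp; lia.
pose T b a := qmul a (qconj (qred b)) == qreal 0.
pose Z := [set a : quat F | (a != qreal 0) && (qnorm a == 0)].
have red_ne0 b : b \in quats p -> qred b != qreal 0 /\ qnorm (qred b) = 0.
  rewrite mem_quats => /eqP nb; split; last first.
    by apply/eqP; rewrite qnorm_red nb intr_Fp_eq0.
  rewrite qred_eq0; apply/qdvdzP => -[c cE]; move: nb; rewrite cE qnorm_scal.
  rewrite -[RHS]mulr1 expr2 -mulrA => /(mulfI p0) h.
  have : (p%:Z %| p%:Z * qnorm c)%Z by rewrite dvdz_mulr.
  by rewrite h dvdz1 absz_nat => /eqP p1; move: pp; rewrite p1.
have e1 : (\sum_(b <- quats p) \sum_(a in Z) T b a = size (quats p) * (p ^ 2 - 1))%N.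
  rewrite big_seq (eq_bigr (fun=> (p ^ 2 - 1)%N)) -?big_seq ?sum_nat_seq_const //.
    by rewrite big_const_seq count_predT iter_addn_0 mulnC.
  move=> b /red_ne0[b0 nb]; rewrite -big_mkcondr sum1dep_card.
  rewrite -(@card_annihilated_quat (qconj (qred b))) ?qnormC_eq0 ?qnormC //.
  apply: eq_card => a; rewrite !inE -andbA; congr andb.
  rewrite /T; have [e|_] := boolP (qmul a _ == _); last by rewrite andbF.
  by rewrite (qnorm_conj_eq0 b0 e) eqxx.
have e2 : (\sum_(b <- quats p) \sum_(a in Z) T b a = #|Z| * 8)%N.
  rewrite exchange_big /= -sum_nat_const; apply: eq_bigr => a; rewrite inE => /andP[a0 na].
  (* A nonzero null a lifts to an integral quaternion not divisible by p whose norm is; for b of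
     norm p, [T b a] says that b right-divides the lift. *)
  rewrite -(@primitive_rdvd_count p (qlift a)) ?qliftK //; last 2 first.
  - by rewrite -intr_Fp_eq0 // -qnorm_red qliftK.
  - by rewrite -qred_eq0 qliftK.
  rewrite -sum1_count [RHS]big_mkcond; apply: eq_big_seq => b; rewrite mem_quats => /eqP nb.
  by rewrite /T /rdvdq nb -qred_eq0 qredM qredC qliftK; case: eqP.
move: e1; rewrite e2 card_null_quat => /esym e.
have p1 := prime_gt1 pp; have pos : (0 < p ^ 2 - 1)%N by rewrite subn_gt0 -{1}(exp1n 2) ltn_exp2r.
apply/eqP; rewrite -(eqn_pmul2r pos) e; apply/eqP; ring.
Qed.

End CountPrimeNorm.

(** * The Hecke relation *)

Lemma sum_quats_bij (N : nat) (f g : quat int -> quat int) (F : quat int -> int) :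
  cancel f g -> cancel g f -> (forall a, qnorm (f a) = qnorm a) ->
  \sum_(a <- quats N) F (f a) = \sum_(a <- quats N) F a.
Proof.
move=> fK gK nf; apply/esym/(big_seq_bij (g := g)); rewrite ?quats_uniq //.
- by move=> a; rewrite !mem_quats nf.
- by move=> a; rewrite !mem_quats -{1}[a]gK nf.
Qed.

Definition rot1 (a : quat int) : int * int * int :=
  let: (x, y, z, w) := a in
  (x ^+ 2 + y ^+ 2 - z ^+ 2 - w ^+ 2, 2 * (y * z - x * w), 2 * (y * w + x * z)).
Definition rot2 (a : quat int) : int * int :=
  let: (x, y, z, w) := a in
  (2 * (y * z + x * w), x ^+ 2 - y ^+ 2 + z ^+ 2 - w ^+ 2).
Definition rot3 (a : quat int) : int * int :=
  let: (x, y, z, w) := a in (2 * (y * w - x * z), 2 * (z * w + x * y)).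

(* [rot1], [rot2], [rot3] are (parts of) the rows of the matrix R(a) of the
   rotation v |-> a v a^*, so that R(ab) = R(a) R(b); averaging over the units
   1, i, j, k kills the cross terms of the squared entries of R(a u b). *)
Definition harm (a : quat int) : int := (rot1 a).1.1 ^+ 2 - (rot1 a).1.2 ^+ 2.

Definition qi : quat int := (0, 1, 0, 0).
Definition qj : quat int := (0, 0, 1, 0).
Definition qk : quat int := (0, 0, 0, 1).
Definition units4 : seq (quat int) := [:: qreal 1; qi; qj; qk].

Lemma rot1M (a b : quat int) :
  let A := rot1 a in let B1 := rot1 b in let B2 := rot2 b in let B3 := rot3 b in
  (rot1 (qmul a b)).1 =
    (A.1.1 * B1.1.1 + A.1.2 * B2.1 + A.2 * B3.1,
     A.1.1 * B1.1.2 + A.1.2 * B2.2 + A.2 * B3.2).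
Proof.
move: a b => [[[? ?] ?] ?] [[[? ?] ?] ?].
by rewrite /rot1 /rot2 /rot3 /qmul /=; congr (_, _); ring.
Qed.

Lemma harm_average (a b : quat int) :
  \sum_(u <- units4) harm (qmul a (qmul u b)) =
  4 * ((rot1 a).1.1 ^+ 2 * harm b + (rot1 a).1.2 ^+ 2 * ((rot2 b).1 ^+ 2 - (rot2 b).2 ^+ 2)
     + (rot1 a).2 ^+ 2 * ((rot3 b).1 ^+ 2 - (rot3 b).2 ^+ 2)).
Proof.
rewrite /harm /units4 !big_cons big_nil !(rot1M a).
have u0 : [/\ rot1 (qmul (qreal 1) b) = rot1 b,
   rot2 (qmul (qreal 1) b) = rot2 b & rot3 (qmul (qreal 1) b) = rot3 b].
  by rewrite qmul1l.
(* Left multiplication by i, j, k applies diag(1, -1, -1), diag(-1, 1, -1), diag(-1, -1, 1) to the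
   rows, so the products of two different rows cancel in the sum. *)
have u1 : [/\ rot1 (qmul qi b) = rot1 b,
   rot2 (qmul qi b) = (- (rot2 b).1, - (rot2 b).2) &
   rot3 (qmul qi b) = (- (rot3 b).1, - (rot3 b).2)].
  case: (b) => [[[? ?] ?] ?]; rewrite /rot1 /rot2 /rot3 /qmul /qi /qj /qk /=.
  by split; [congr (_, _, _)|congr (_, _)|congr (_, _)]; ring.
have u2 : [/\ rot1 (qmul qj b) = (- (rot1 b).1.1, - (rot1 b).1.2, - (rot1 b).2),
   rot2 (qmul qj b) = rot2 b &
   rot3 (qmul qj b) = (- (rot3 b).1, - (rot3 b).2)].
  case: (b) => [[[? ?] ?] ?]; rewrite /rot1 /rot2 /rot3 /qmul /qi /qj /qk /=.
  by split; [congr (_, _, _)|congr (_, _)|congr (_, _)]; ring.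
have u3 : [/\ rot1 (qmul qk b) = (- (rot1 b).1.1, - (rot1 b).1.2, - (rot1 b).2),
   rot2 (qmul qk b) = (- (rot2 b).1, - (rot2 b).2) &
   rot3 (qmul qk b) = rot3 b].
  case: (b) => [[[? ?] ?] ?]; rewrite /rot1 /rot2 /rot3 /qmul /qi /qj /qk /=.
  by split; [congr (_, _, _)|congr (_, _)|congr (_, _)]; ring.
have [-> -> ->] := u0; have [-> -> ->] := u1; have [-> -> ->] := u2; have [-> -> ->] := u3.
rewrite /=.
move: (rot1 a) (rot1 b) (rot2 b) (rot3 b) => [[? ?] ?] [[? ?] ?] [? ?] [? ?] /=.
ring.
Qed.

Definition hsum (N : nat) : int := \sum_(a <- quats N) harm a.

(** Exchanging the coordinates of i and j maps R11 to R22; negating the real coordinate transposes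
    R, exchanging R12 and R21. *)
Lemma sum_rot2 (N : nat) :
  \sum_(b <- quats N) ((rot2 b).1 ^+ 2 - (rot2 b).2 ^+ 2) = - hsum N.
Proof.
pose f (q : quat int) : quat int := let: (x, y, z, w) := q in (x, z, y, w).
pose g (q : quat int) : quat int := let: (x, y, z, w) := q in (- x, y, z, w).
have fK : cancel f f by move=> [[[? ?] ?] ?].
have gK : cancel g g by move=> [[[? ?] ?] ?]; rewrite /g opprK.
rewrite /hsum !sumrB opprB; congr (_ - _).
  rewrite -(sum_quats_bij _ (fun b => (rot1 b).1.2 ^+ 2) gK gK); last first.
    by move=> [[[? ?] ?] ?] /=; ring.
  by apply: eq_bigr => -[[[? ?] ?] ?] _ /=; ring.
rewrite -(sum_quats_bij _ (fun b => (rot1 b).1.1 ^+ 2) fK fK); last first.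
  by move=> [[[? ?] ?] ?] /=; ring.
by apply: eq_bigr => -[[[? ?] ?] ?] _ /=; ring.
Qed.

Lemma sum_rot3 (N : nat) :
  \sum_(b <- quats N) ((rot3 b).1 ^+ 2 - (rot3 b).2 ^+ 2) = 0.
Proof.
pose f (q : quat int) : quat int := let: (x, y, z, w) := q in (- x, z, y, w).
have fK : cancel f f by move=> [[[? ?] ?] ?]; rewrite /f opprK.
rewrite sumrB -(sum_quats_bij _ (fun b => (rot3 b).2 ^+ 2) fK fK); last first.
  by move=> [[[? ?] ?] ?] /=; ring.
apply/eqP; rewrite subr_eq0; apply/eqP.
by apply: eq_bigr => -[[[? ?] ?] ?] _ /=; ring.
Qed.

(** Left multiplication by a unit permutes the b of norm N, so the average may be inserted. Summed
    over b, the three brackets give h(N), -h(N) and 0, leaving [harm a] times h(N): the quartic is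
    chosen to reproduce itself. *)
Lemma sum_harmM (M N : nat) :
  \sum_(a <- quats M) \sum_(b <- quats N) harm (qmul a b) = hsum M * hsum N.
Proof.
apply: (@mulfI _ 4) => //; rewrite mulr_sumr.
have unit4 u (F : quat int -> int) : u \in units4 ->
    \sum_(b <- quats N) F (qmul u b) = \sum_(b <- quats N) F b.
  move=> hu; have nu : qnorm u = 1.
    by move: hu; rewrite !inE => /or4P[] /eqP->.
  apply: (@sum_quats_bij N _ (qmul (qconj u))).
  - by move=> b; rewrite qmulCK nu qscal1.
  - by move=> b; rewrite -{1}[u]qconjK qmulCK qnormC nu qscal1.
  - by move=> b; rewrite qnormM nu mul1r.
rewrite [RHS]mulrA [4 * hsum M]mulr_sumr mulr_suml; apply: eq_bigr => a _.
transitivity (\sum_(u <- units4) \sum_(b <- quats N) harm (qmul a (qmul u b))).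
  transitivity (\sum_(u <- units4) \sum_(b <- quats N) harm (qmul a b)).
    by rewrite !big_cons big_nil; ring.
  by apply: eq_big_seq => u /unit4 h; rewrite (h (fun x => harm (qmul a x))).
rewrite exchange_big /= (eq_bigr _ (fun b _ => harm_average a b)) -mulr_sumr !big_split /=.
by rewrite -!mulr_sumr sum_rot2 sum_rot3 -/(hsum N) /harm; ring.
Qed.

Definition qdivz (n : int) (a : quat int) : quat int :=
  let: (x, y, z, w) := a in ((x %/ n)%Z, (y %/ n)%Z, (z %/ n)%Z, (w %/ n)%Z).

Lemma qscalK (n : int) : n != 0 -> cancel (qscal n) (qdivz n).
Proof. by move=> n0 [[[x y] z] w]; rewrite /= !mulKz. Qed.

Lemma harm_scal n a : harm (qscal n a) = n ^+ 4 * harm a.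
Proof. by case: a => [[[? ?] ?] ?]; rewrite /harm /=; ring. Qed.

Theorem hecke_hsum (p N : nat) : prime p -> odd p ->
  hsum N * hsum p =
  8 * (hsum (p * N) + p%:Z ^+ 5 * (if (p %| N)%N then hsum (N %/ p) else 0)).
Proof.
move=> pp op; have p0 : p%:Z != 0 by have := prime_gt0 pp; lia.
rewrite -sum_harmM exchange_big /=.
transitivity (\sum_(b <- quats p) \sum_(g <- quats (p * N) | rdvdq b g) harm g).
  apply: eq_big_seq => b; rewrite mem_quats => /eqP nb.
  have nb0 : qnorm b != 0 by rewrite nb.
  rewrite -[RHS]big_filter; apply/esym.
  apply: (big_seq_bij (g := fun g => qdivz p%:Z (qmul g (qconj b)))).
  - exact: quats_uniq.
  - by rewrite filter_uniq ?quats_uniq.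
  - move=> a; rewrite mem_quats mem_filter mem_quats qnormM nb PoszM mulrC => /eqP->.
    by rewrite eqxx andbT; apply/rdvdqP => //; exists a.
  - move=> g; rewrite mem_filter !mem_quats => /andP[/(rdvdqP _ nb0)[c ->]].
    rewrite qnormM -qmulA qmulC qMreal nb qscalK // PoszM mulrC.
    by move=> /eqP/(mulfI p0)->.
  - by move=> a _; rewrite -qmulA qmulC qMreal nb qscalK.
  - move=> g; rewrite mem_filter => /andP[/(rdvdqP _ nb0)[c ->] _].
    by rewrite -qmulA qmulC qMreal nb qscalK.
rewrite (exchange_big_dep xpredT) //=.
(* Each g has 8 right divisors of norm p, and 8p more if p divides g, since then every b of norm p
   divides it through p = conj(b) b. *)
transitivity (\sum_(g <- quats (p * N)) (8 * harm g + 8 * p%:Z * (if qdvdz p%:Z g then harm g else 0))).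
  apply: eq_big_seq => g; rewrite mem_quats => /eqP ng.
  rewrite -big_filter big_const_seq count_predT size_filter -Monoid.iteropE /=.
  have -> : iterop (count (rdvdq^~ g) (quats p)) +%R (harm g) 0 = harm g *+ count (rdvdq^~ g) (quats p) by [].
  case: ifPn => pg.
    rewrite (_ : count _ _ = 8 * p.+1)%N; last first.
      rewrite -(size_quats_prime pp op); apply/eqP; rewrite -all_count; apply/allP => b.
      rewrite mem_quats => /eqP nb; have [c ->] := qdvdzP _ _ pg.
      apply/rdvdqP; first by rewrite nb.
      by exists (qmul c (qconj b)); rewrite -qmulA qCmul qMreal nb.
    by rewrite -[LHS]mulr_natl natrM -[p.+1]addn1 natrD -natz; ring.
  rewrite primitive_rdvd_count // ?ng ?PoszM ?dvdz_mulr //.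
  by rewrite -[LHS]mulr_natl; ring.
rewrite big_split /= -!mulr_sumr -big_mkcond /= -/(hsum _).
(* Such g are p c with norm(c) = N/p; the degree of the quartic gives p^4, and with the factor p
   above p^5. *)
suff -> : \sum_(g <- quats (p * N) | qdvdz p%:Z g) harm g
   = p%:Z ^+ 4 * (if (p %| N)%N then hsum (N %/ p) else 0) by ring.
rewrite -big_filter; case: ifPn => pN; last first.
  rewrite mulr0 big_seq big1 // => g; rewrite mem_filter mem_quats.
  case/andP => /qdvdzP[c ->]; rewrite qnorm_scal PoszM expr2 -mulrA => /eqP/(mulfI p0) h.
  by case/negP: pN; rewrite -[(p %| N)%N]/(p%:Z %| N%:Z)%Z -h dvdz_mulr.
rewrite /hsum mulr_sumr.
under [RHS]eq_bigr do rewrite -harm_scal.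
have nE : (p%:Z * (N %/ p)%N%:Z = N%:Z) by rewrite -PoszM mulnC divnK.
have fu := filter_uniq (qdvdz p%:Z) (quats_uniq (p * N)).
apply: (big_seq_bij (f := qscal p%:Z) (g := qdivz p%:Z) _ (quats_uniq _) fu).
- move=> a; rewrite mem_quats mem_filter mem_quats qnorm_scal PoszM => /eqP->.
  by rewrite expr2 -mulrA nE eqxx andbT; apply/qdvdzP; exists a.
- move=> g; rewrite mem_filter !mem_quats => /andP[/qdvdzP[c ->]].
  by rewrite qnorm_scal qscalK // PoszM expr2 -mulrA -{1}nE => /eqP/(mulfI p0)/(mulfI p0)->.
- by move=> a _; rewrite qscalK.
- by move=> g; rewrite mem_filter => /andP[/qdvdzP[c ->] _]; rewrite qscalK.
Qed.

(** * The twelfth power of the Euler product *)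

Definition qprod (a : quat int) : int := let: (x, y, z, w) := a in x * y * z * w.
Definition qsum (a : quat int) : int := let: (x, y, z, w) := a in x + y + z + w.

(* Quadruples of odd integers with sum of squares 4N (N odd) are the products
   a * eta and a * conj(eta), a a Lipschitz quaternion of norm N; the two kinds
   are told apart by the sum of the coordinates mod 4. *)
Definition eta : quat int := (-1, 1, 1, 1).

(** The two quartics agree only after averaging over symmetries of the norm: the sign of the real
    coordinate and cyclic permutations of i, j, k ([key]). *)
Lemma sum_qprod_eta (N : nat) :
  \sum_(a <- quats N) (qprod (qmul a (qconj eta)) - qprod (qmul a eta)) = 2 * hsum N.
Proof.
pose s (q : quat int) : quat int := let: (x, y, z, w) := q in (- x, y, z, w).
pose c (q : quat int) : quat int := let: (x, y, z, w) := q in (x, z, w, y).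
pose c' (q : quat int) : quat int := let: (x, y, z, w) := q in (x, w, y, z).
have sK : cancel s s by move=> [[[? ?] ?] ?]; rewrite /s opprK.
have cK : cancel c c' by move=> [[[? ?] ?] ?].
have cK' : cancel c' c by move=> [[[? ?] ?] ?].
have ns a : qnorm (s a) = qnorm a by move: a => [[[? ?] ?] ?] /=; ring.
have nc a : qnorm (c a) = qnorm a by move: a => [[[? ?] ?] ?] /=; ring.
have nc' a : qnorm (c' a) = qnorm a by move: a => [[[? ?] ?] ?] /=; ring.
pose g a := qprod (qmul a (qconj eta)) - qprod (qmul a eta).
rewrite (eq_bigr g) //.
have key a : 3 * (g a + g (s a)) = 2 * (harm a + harm (c a) + harm (c' a)
    + (harm (s a) + harm (c (s a)) + harm (c' (s a)))).
  by move: a => [[[? ?] ?] ?]; rewrite /g /harm /=; ring.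
clearbody s c c' g; rewrite /hsum; move: harm key => h key.
apply: (@mulfI _ 6) => //.
have -> : 6 * \sum_(a <- quats N) g a = \sum_(a <- quats N) 3 * (g a + g (s a)).
  by rewrite -mulr_sumr big_split /= (sum_quats_bij _ g sK sK ns); ring.
rewrite (eq_bigr _ (fun a _ => key a)) -mulr_sumr !big_split /=.
rewrite (sum_quats_bij _ h cK cK' nc) (sum_quats_bij _ h cK' cK nc').
rewrite (sum_quats_bij _ h sK sK ns).
rewrite (sum_quats_bij _ (fun a => h (c a)) sK sK ns) (sum_quats_bij _ h cK cK' nc).
rewrite (sum_quats_bij _ (fun a => h (c' a)) sK sK ns) (sum_quats_bij _ h cK' cK nc').
ring.
Qed.

Definition triang (a : quat int) : int :=
  let: (x, y, z, w) := a in x * (x + 1) + y * (y + 1) + z * (z + 1) + w * (w + 1).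

(** Indices of four triangular numbers with sum n; through [odds] they become the quadruples of odd
    integers with sum of squares 4(2n + 1). *)
Definition quadtri (n : nat) : seq (quat int) :=
  [seq a <- zgrid n.+1 | triang a == (n.*2)%:Z].

Lemma tri_bound (x : int) (n : nat) : x * (x + 1) <= n.*2%:Z -> `|x| <= n.+1%:Z.
Proof. by move=> h; nia. Qed.

Lemma tri_ge0 (x : int) : 0 <= x * (x + 1).
Proof. by nia. Qed.

Lemma quadtri_uniq n : uniq (quadtri n).
Proof. by rewrite filter_uniq ?zgrid_uniq. Qed.

Lemma mem_quadtri n a : (a \in quadtri n) = (triang a == n.*2%:Z).
Proof.
rewrite mem_filter; case: eqP => // h; rewrite andTb.
case: a h => [[[a b] c] d]; rewrite {1}/triang => h.
have ha := tri_ge0 a; have hb := tri_ge0 b; have hc := tri_ge0 c; have hd := tri_ge0 d.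
by apply: mem_zgrid; apply: tri_bound; lia.
Qed.

Definition odds (a : quat int) : quat int :=
  let: (x, y, z, w) := a in (2 * x + 1, 2 * y + 1, 2 * z + 1, 2 * w + 1).
Definition halves (a : quat int) : quat int :=
  let: (x, y, z, w) := a in ((x %/ 2)%Z, (y %/ 2)%Z, (z %/ 2)%Z, (w %/ 2)%Z).

Lemma qnorm_odds a : qnorm (odds a) = 4 * triang a + 4.
Proof. by case: a => [[[? ?] ?] ?] /=; ring. Qed.

Lemma oddsK : cancel odds halves.
Proof. by move=> [[[x y] z] w] /=; congr (_, _, _, _); lia. Qed.

(** Meant for e = [eta] and its conjugate. The coordinates of [odds z] add up to 2 [qsum z] + 4, so
    the parity of [qsum z] tells which of the two divides; the inverse of a |-> a e is division by 4
    after multiplying by conj(e). *)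
Lemma sum_quadtri_half (e : quat int) (b : bool) (n : nat) (F : quat int -> int) :
  qnorm e = 4 ->
  (forall a, (odd (absz (qsum a)) == b) = qdvdz 4 (qmul (odds a) (qconj e))) ->
  (forall a, odd (absz (qnorm a)) -> odds (halves (qmul a e)) = qmul a e) ->
  \sum_(z <- quadtri n | odd (absz (qsum z)) == b) F (odds z) =
  \sum_(a <- quats n.*2.+1) F (qmul a e).
Proof.
move=> ne dvde oe; rewrite -big_filter.
have oe' a : a \in quats n.*2.+1 -> odds (halves (qmul a e)) = qmul a e.
  by rewrite mem_quats => /eqP na; apply: oe; rewrite na; lia.
under [RHS]eq_big_seq => a ha do rewrite -(oe' a ha).
have fu := filter_uniq (fun z => odd (absz (qsum z)) == b) (quadtri_uniq n).
apply: (big_seq_bij (f := fun a => halves (qmul a e))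
  (g := fun z => qdivz 4 (qmul (odds z) (qconj e))) (fun z => F (odds z)) (quats_uniq _) fu).
- move=> a ha; rewrite mem_filter dvde oe' // -qmulA qmulC ne qMreal mem_quadtri.
  rewrite (_ : qdvdz _ _); last by apply/qdvdzP; exists a.
  have := qnorm_odds (halves (qmul a e)); rewrite oe' // qnormM ne.
  by move: ha; rewrite mem_quats => /eqP ->; lia.
- move=> z; rewrite mem_filter dvde mem_quadtri => /andP[/qdvdzP[c cE] /eqP tz].
  rewrite cE qscalK // mem_quats.
  have : qnorm (qmul (odds z) (qconj e)) = 16 * qnorm c by rewrite cE qnorm_scal.
  by rewrite qnormM qnormC ne qnorm_odds tz; lia.
- by move=> a ha; rewrite oe' // -qmulA qmulC ne qMreal qscalK.
- move=> z; rewrite mem_filter dvde => /andP[/qdvdzP[c cE] _].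
  rewrite cE qscalK // -[RHS]oddsK; congr halves; apply: (@qscalI 4) => //.
  by rewrite -qscalMl -cE -qmulA qCmul ne qMreal.
Qed.

Lemma odd_abszD (a b : int) : odd (absz (a + b)) = odd (absz a) (+) odd (absz b).
Proof. by lia. Qed.

Lemma odd_qnorm a : odd (absz (qnorm a)) = odd (absz (qsum a)).
Proof.
have e (z : int) : odd (absz (z * z)) = odd (absz z) by rewrite abszM oddM andbb.
by case: a => [[[x y] z] w]; rewrite /qnorm /qsum !expr2 !odd_abszD !e.
Qed.

Theorem sum_quadtri (n : nat) :
  \sum_(z <- quadtri n) (-1) ^+ (absz (qsum z)) * qprod (odds z) = 2 * hsum n.*2.+1.
Proof.
rewrite (bigID (fun z => odd (absz (qsum z)) == true)) /=.
rewrite -sum_qprod_eta sumrB addrC.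
rewrite (eq_bigl (fun z => odd (absz (qsum z)) == false)); last first.
  by move=> z; case: (odd _).
congr (_ + _).
  transitivity (\sum_(z <- quadtri n | odd (absz (qsum z)) == false) qprod (odds z)).
    by apply: eq_bigr => z /eqP; rewrite -signr_odd => ->; rewrite mul1r.
  apply: sum_quadtri_half => //.
  - move=> [[[x y] z] w]; rewrite /qdvdz /=; apply/eqP/and4P; last by case; lia.
    by move=> h; split; lia.
  - move=> a; rewrite odd_qnorm; case: a => [[[x y] z] w]; rewrite /qsum => h.
    by rewrite /=; congr (_, _, _, _); lia.
rewrite -sumrN.
transitivity (\sum_(z <- quadtri n | odd (absz (qsum z)) == true) - qprod (odds z)).
  by apply: eq_bigr => z /eqP; rewrite -signr_odd => ->; rewrite mulN1r.
apply: (@sum_quadtri_half _ _ _ (fun a => - qprod a)) => //.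
- move=> [[[x y] z] w]; rewrite /qdvdz /=; apply/eqP/and4P; last by case; lia.
  by move=> h; split; lia.
- move=> a; rewrite odd_qnorm; case: a => [[[x y] z] w]; rewrite /qsum => h.
  by rewrite /=; congr (_, _, _, _); lia.
Qed.

Lemma sum_zbox (V : nmodType) N (F : int -> V) :
  \sum_(z <- zbox N) F z = F 0 + \sum_(1 <= j < N.+1) (F j%:Z + F (- j%:Z)).
Proof.
rewrite big_split /= /index_iota subSS subn0.
rewrite -(big_map Posz xpredT F) -(big_map (fun j => - j%:Z) xpredT F) -big_cat.
rewrite -[RHS](big_cons _ _ 0 _ xpredT F); apply: perm_big; apply: uniq_perm.
- exact: zbox_uniq.
- have u1 : uniq (map Posz (iota 1 N)) by rewrite map_inj_uniq ?iota_uniq // => x y [].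
  have u2 : uniq (map (fun j => - j%:Z) (iota 1 N)).
    by rewrite map_inj_uniq ?iota_uniq // => x y; lia.
  rewrite cons_uniq cat_uniq u1 u2 mem_cat negb_or andbT /=; apply/andP; split.
  + by apply/andP; split; apply/mapP => -[j]; rewrite mem_iota; lia.
  + by apply/hasPn => x /mapP[j]; rewrite mem_iota => hj ->; apply/mapP => -[k]; rewrite mem_iota; lia.
move=> z; rewrite mem_zbox inE mem_cat; apply/idP/or3P.
  case: z => [[|j]|j] h; first by constructor 1.
    by constructor 2; apply/mapP; exists j.+1; rewrite // mem_iota; lia.
  by constructor 3; apply/mapP; exists j.+1; rewrite ?NegzE // mem_iota; lia.
case=> [/eqP->|/mapP[j]|/mapP[j]]; first by lia.
  by rewrite mem_iota => h ->; lia.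
by rewrite mem_iota => h ->; lia.
Qed.

Lemma tri_double k : (tri k).*2 = (k * k.+1)%N.
Proof. by elim: k => // k IH; rewrite triS doubleD IH; lia. Qed.

Section EulerCoefficients.
Variable R : comNzRingType.

(** The exponents k^2 + tri (k - 1) and k^2 + tri k are z (3z - 1)/2 at z = k and z = -k. *)
Lemma coef_euler N n : (n <= N)%N ->
  (euler R 1 N)`_n = \sum_(z <- zbox N | z * (3 * z - 1) == n.*2%:Z) (-1) ^+ absz z.
Proof.
move=> nN; rewrite euler_pentagonal // coefD coef1 coef_sum [RHS]big_mkcond sum_zbox; congr (_ + _).
  by rewrite mul0r expr0; case: n nN.
apply: eq_big_nat => -[|j] // _.
have sgn (q : {poly R}) : ((-1) ^+ j.+1 * q)`_n = (-1) ^+ j.+1 * q`_n.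
  by rewrite -[in LHS]signr_odd -[in RHS]signr_odd; case: odd; rewrite ?mulN1r ?coefN ?mul1r.
rewrite sgn coefD !coefXn mulrDr absz_nat abszN absz_nat.
have d := tri_double j; congr (_ + _).
  have -> : (n == j.+1 ^ 2 + tri j)%N = (j.+1%:Z * (3 * j.+1%:Z - 1) == n.*2%:Z).
    by apply/eqP/eqP => h; nia.
  by case: ifP => _; rewrite ?mulr1 ?mulr0.
have -> : (n == j.+1 ^ 2 + tri j.+1)%N = (- j.+1%:Z * (3 * - j.+1%:Z - 1) == n.*2%:Z).
  by rewrite triS; apply/eqP/eqP => h; nia.
by case: ifP => _; rewrite ?mulr1 ?mulr0.
Qed.

Lemma euler_comp k N : euler R k N = euler R 1 N \Po 'X^k.
Proof.
rewrite /euler rmorph_prod; apply: eq_bigr => i _.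
by rewrite rmorphB rmorph1 /= comp_Xn_poly mul1n exprM.
Qed.

(* A pentagonal number z(3z-1)/2 is 2 mod 7 exactly when z = 7y - 1, and then
   it equals 49 y(3y-1)/2 + 2. *)
Lemma coef_euler_7k2 N k : (7 * k + 2 <= N)%N ->
  (euler R 1 N)`_(7 * k + 2) = - (euler R 7 N)`_k.
Proof.
move=> kN; rewrite coef_euler // euler_comp coef_comp_poly_Xn //.
transitivity (\sum_(y <- zbox N | 7 * (y * (3 * y - 1)) == k.*2%:Z) - (-1) ^+ absz y : R).
  rewrite -[LHS]big_filter -[RHS]big_filter.
  have pent (z : int) : z * (3 * z - 1) = (7 * k + 2).*2%:Z -> exists y, z = 7 * y - 1.
    move=> h; exists ((z + 1) %/ 7)%Z.
    have : (7 %| z + 1)%Z.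
      (* Modulo 7, z (3z - 1) = 4 amounts to 3 (z + 1)^2 = 0. *)
      have : (7 %| (z + 1) * (z + 1))%Z.
        rewrite -(@Gauss_dvdzr 7 3) //; apply/dvdzP; exists (2 * k%:Z + z + 1).
        have {}h : z * (3 * z - 1) = 14 * k%:Z + 4 by rewrite h; lia.
        transitivity (z * (3 * z - 1) + 7 * z + 3); first by ring.
        by rewrite h; ring.
      by rewrite !dvdzE abszM Euclid_dvdM // orbb.
    by move=> /dvdzP[q e]; rewrite e mulzK // mulrC -e addrK.
  have pent7 (y : int) : ((7 * y - 1) * (3 * (7 * y - 1) - 1) == (7 * k + 2).*2%:Z) = (7 * (y * (3 * y - 1)) == k.*2%:Z).
    have -> : (7 * y - 1) * (3 * (7 * y - 1) - 1) = 7 * (7 * (y * (3 * y - 1))) + 4 by ring.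
    by apply/eqP/eqP; lia.
  have inbox (m : nat) (z : int) : z * (3 * z - 1) = m.*2%:Z -> (m <= N)%N -> z \in zbox N.
    by rewrite mem_zbox => h mN; nia.
  rewrite (@big_seq_bij _ _ _ [seq y <- zbox N | 7 * (y * (3 * y - 1)) == k.*2%:Z] _
    (fun y => 7 * y - 1) (fun z => ((z + 1) %/ 7)%Z)) ?filter_uniq ?zbox_uniq //.
  - apply: eq_big_seq => y _; rewrite -[LHS]signr_odd -[in RHS]signr_odd.
    have -> : odd (absz (7 * y - 1)%R) = ~~ odd (absz y) by lia.
    by case: odd; rewrite /= ?expr0 ?expr1 ?opprK.
  - move=> y; rewrite !mem_filter => /andP[hy _]; rewrite pent7 hy /=.
    by apply: (inbox (7 * k + 2)%N) => //; apply/eqP; rewrite pent7.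
  - move=> z; rewrite !mem_filter => /andP[/eqP hz _]; have [y zE] := pent _ hz.
    have hy : 7 * (y * (3 * y - 1)) == k.*2%:Z by rewrite -pent7 -zE hz.
    rewrite zE subrK mulKz // hy /=; apply: (inbox (k %/ 7)%N); last by lia.
    by move/eqP: hy; lia.
  - by move=> y _; rewrite subrK mulKz.
  - by move=> z; rewrite !mem_filter => /andP[/eqP/pent[y ->] _]; rewrite subrK mulKz.
rewrite sumrN; congr (- _); case: ifPn => k7.
  rewrite coef_euler; last by lia.
  apply: eq_bigl => y; case/dvdnP: k7 => j ->; rewrite mulnK //.
  by apply/eqP/eqP; lia.
rewrite big1 // => y /eqP h; case/negP: k7.
by have : (7 %| k.*2%:Z)%Z; [rewrite -h dvdz_mulr|lia].
Qed.

End EulerCoefficients.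

Definition jacobi_coef (z : int) : int := (-1) ^+ absz z * (2 * z + 1).
Definition ztri (z : int) : nat := (absz (z * (z + 1)))./2.

(** z and -1 - z give the same term of Jacobi's series, hence the factor 2. In the symmetric box the
    index n + 1 has no partner, but its degree tri (n + 1) exceeds n. *)
Lemma jacobi_zbox n :
  eqmX n.+1 (\sum_(z <- zbox n.+1) jacobi_coef z *: 'X^(ztri z)) (2 * euler int 1 n ^+ 3).
Proof.
pose g (k : nat) : {poly int} := ((-1) ^+ k * 'X^(tri k)) *+ k.*2.+1.
have Fp (k : nat) : jacobi_coef k%:Z *: 'X^(ztri k%:Z) = g k.
  have -> : ztri k%:Z = tri k by rewrite /ztri; have := tri_double k; lia.
  rewrite /jacobi_coef absz_nat -mul_polyC rmorphM rmorphXn rmorphN rmorph1 /=.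
  have -> : (2 * k%:Z + 1 = k.*2.+1%:R :> int) by rewrite natz; lia.
  by rewrite polyC_natr /g -mulr_natr; ring.
have Fn (k : nat) : jacobi_coef (- k.+1%:Z) *: 'X^(ztri (- k.+1%:Z)) = g k.
  rewrite -Fp; have -> : ztri (- k.+1%:Z) = ztri k%:Z.
    by rewrite /ztri; congr ((absz _)./2); rewrite intS; ring.
  congr (_ *: _); rewrite /jacobi_coef abszN !absz_nat exprS intS; ring.
rewrite sum_zbox; have -> : jacobi_coef 0 *: 'X^(ztri 0) +
    \sum_(1 <= j < n.+2) (jacobi_coef j%:Z *: 'X^(ztri j%:Z) + jacobi_coef (- j%:Z) *: 'X^(ztri (- j%:Z)))
  = 2 * (\sum_(k < n.+1) g k) + g n.+1.
  rewrite -[jacobi_coef 0 *: _]/(jacobi_coef 0%:Z *: 'X^(ztri 0%:Z)) Fp big_add1 /= big_split /=.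
  under [X in _ + (X + _)]eq_bigr do rewrite Fp.
  under [X in _ + (_ + X)]eq_bigr do rewrite Fn.
  rewrite addrA -big_nat_recl //= big_nat_recr //= !big_mkord; ring.
rewrite -[X in eqmX _ _ X]addr0; apply: eqmXD.
  by apply: eqmXM => //; apply/eqmX_sym/jacobi_cube.
move=> i iN; rewrite /g coefMn coef0.
have -> : (-1) ^+ n.+1 * 'X^(tri n.+1) = 'X^(tri n.+1) * (-1) ^+ n.+1 :> {poly int} by ring.
by rewrite coefXnM ifT ?mul0rn // (leq_trans iN) // leq_tri.
Qed.

(** The fourth power of 2 E_1^3 expands into the signed sum over [quadtri n], which is 2 h(2n + 1);
    so 2 h(2n + 1) is 16 times the coefficient. *)
Theorem hsum_euler12 n : hsum n.*2.+1 = 8 * (euler int 1 n ^+ 12)`_n.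
Proof.
apply: (@mulfI _ 2) => //; rewrite -sum_quadtri.
have := eqmX_exp 4 (@jacobi_zbox n) (ltnSn n); rewrite exprMn -exprM.
have -> : (2 : {poly int}) ^+ 4 = 16%:P by rewrite -[2]polyC_natr -rmorphXn.
rewrite coefCM mulrA => <-.
have -> : (\sum_(z <- zbox n.+1) jacobi_coef z *: 'X^(ztri z)) ^+ 4 =
  \sum_(q <- zgrid n.+1) (jacobi_coef q.1.1.1 * jacobi_coef q.1.1.2 * jacobi_coef q.1.2 * jacobi_coef q.2)
     *: 'X^(ztri q.1.1.1 + ztri q.1.1.2 + ztri q.1.2 + ztri q.2).
  rewrite /zgrid !big_allpairs !exprSr expr0 mul1r /= !mulr_suml.
  apply: eq_bigr => x _; rewrite [jacobi_coef x *: _ * _]mulr_sumr !mulr_suml.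
  apply: eq_bigr => y _; rewrite [_ * (jacobi_coef y *: _) * _]mulr_sumr !mulr_suml.
  apply: eq_bigr => z _; rewrite mulr_sumr; apply: eq_bigr => w _.
  by rewrite !exprD -!mul_polyC !rmorphM /=; ring.
rewrite coef_sum /quadtri [LHS]big_filter big_mkcond.
apply: eq_bigr => -[[[x y] z] w] _; rewrite coefZ coefXn /=.
have zt (a : int) : (ztri a).*2%:Z = a * (a + 1).
  have ev : odd (absz (a * (a + 1))) = false by rewrite abszM oddM; lia.
  have := odd_double_half (absz (a * (a + 1))); rewrite ev add0n /ztri => ->.
  by have := tri_ge0 a; lia.
have -> : (n == ztri x + ztri y + ztri z + ztri w)%N =
   (x * (x + 1) + y * (y + 1) + z * (z + 1) + w * (w + 1) == n.*2%:Z).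
  by rewrite -!zt; apply/eqP/eqP => h; lia.
case: eqP => _; rewrite ?mulr0 // mulr1 /jacobi_coef.
rewrite -signr_odd !odd_abszD !signr_addb !signr_odd; ring.
Qed.

(** * Regular multipartitions *)

Section Counting.
Variables (R : comNzRingType) (l n : nat).
Hypothesis l0 : (0 < l)%N.

Definition regular_gf : {poly R} :=
  \sum_(s : n.-bseq 'I_n.+1 | is_regular_partition l (bseq_nat s)) 'X^(sumn (bseq_nat s)).

Lemma coef_regular_gf_exp r : (regular_gf ^+ r)`_n = (B l r n)%:R.
Proof.
have -> : regular_gf ^+ r = \sum_(f : {ffun 'I_r -> n.-bseq 'I_n.+1})
    (if [forall i, is_regular_partition l (bseq_nat (f i))]
     then 'X^(\sum_i sumn (bseq_nat (f i))) else 0).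
  rewrite /regular_gf big_mkcond.
  transitivity (\prod_(i < r) \sum_(s : n.-bseq 'I_n.+1)
     (if is_regular_partition l (bseq_nat s) then 'X^(sumn (bseq_nat s)) else 0 : {poly R})).
    by rewrite prodr_const card_ord.
  rewrite bigA_distr_bigA; apply: eq_bigr => f _.
  case: ifP => [/forallP h|/forallPn[i hi]].
    by rewrite (big_morph (fun k => 'X^k : {poly R}) (exprD _) (expr0 _)); apply: eq_bigr => i _; rewrite h.
  by rewrite (bigD1 i) //= (negPf hi) mul0r.
rewrite coef_sum /B -sum1dep_card natr_sum [RHS]big_mkcond.
rewrite (reindex (fun L : r.-tuple (n.-bseq 'I_n.+1) => [ffun i => tnth L i])) /=; last first.
  exists (fun f => [tuple f i | i < r]) => [L _|f _].
    by apply: eq_from_tnth => i; rewrite tnth_mktuple ffunE.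
  by apply/ffunP => i; rewrite ffunE tnth_mktuple.
apply: eq_bigr => L _; rewrite /is_regular_multipartition.
have -> : [forall i, is_regular_partition l (bseq_nat ([ffun i0 => tnth L i0] i))]
   = all (is_regular_partition l) (map_tuple (@bseq_nat n) L).
  apply/forallP/all_tnthP => h i; first by have := h i; rewrite ffunE tnth_map.
  by have := h i; rewrite ffunE tnth_map.
case: all => /=; last by rewrite coef0.
rewrite coefXn eq_sym.
have -> : (\sum_i sumn (bseq_nat ([ffun i0 => tnth L i0] i)) = \sum_(i < r) sumn (tnth (map_tuple (@bseq_nat n) L) i))%N.
  by apply: eq_bigr => i _; rewrite ffunE tnth_map.
by case: eqP.
Qed.

Fixpoint parts_gf (m : nat) : {poly R} :=
  if m is k.+1 then
    parts_gf k * (if (l %| m)%N then 1 else \sum_(0 <= j < n.+1) 'X^(m * j))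
  else 1.

Lemma geometric_eqmX m : (0 < m)%N ->
  eqmX n.+1 ((\sum_(0 <= j < n.+1) 'X^(m * j)) * (1 - 'X^m)) (1 : {poly R}).
Proof.
move=> m0; have -> : (\sum_(0 <= j < n.+1) 'X^(m * j)) * (1 - 'X^m) = 1 - 'X^(m * n.+1) :> {poly R}.
  elim: (n.+1) => [|k IH]; first by rewrite big_geq // muln0; ring.
  by rewrite big_nat_recr //= mulrDl IH mulnS exprD; ring.
by rewrite -[X in eqmX _ _ X]subr0; apply/eqmXB/eqmX_Xn => //; nia.
Qed.

(** The factor 1 - X^m cancels the geometric sum of an allowed part m, and survives as a factor of
    E_l when l divides m. *)
Lemma parts_gf_euler m : eqmX n.+1 (parts_gf m * euler R 1 m) (euler R l (m %/ l)).
Proof.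
elim: m => [|m IH]; first by rewrite div0n !euler0 mulr1.
rewrite divnS // euler1S /=; case: ifP => lm.
  rewrite mulr1 add1n eulerS mulrA; apply: eqmXM => //.
  by rewrite -[(m %/ l).+1]add1n -[1%N]/(nat_of_bool true) -lm -divnS // mulnC divnK.
rewrite add0n -[X in eqmX _ _ X]mulr1.
rewrite (_ : _ * _ * _ = parts_gf m * euler R 1 m * ((\sum_(0 <= j < n.+1) 'X^(m.+1 * j)) * (1 - 'X^(m.+1)))); last by ring.
by apply: eqmXM => //; apply: geometric_eqmX.
Qed.

Lemma regular_partition_cons x s :
  is_regular_partition l (x :: s) =
  [&& (0 < x)%N, ~~ (l %| x)%N, all (fun y => y <= x)%N s & is_regular_partition l s].
Proof.
rewrite /is_regular_partition /is_partition /= path_sortedE; last by move=> ? ? ? h1 h2; apply: leq_trans h2 h1.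
rewrite inE negb_or [_ == x]eq_sym -lt0n -[all (fun y => (y <= x)%N) s]/(all (geq x) s).
by case: (all (geq x) s); case: (sorted geq s); case: (0 < x)%N; case: (0%N \notin s);
  case: (l %| x)%N; case: (all _ s).
Qed.

(** Either the largest part, which comes first, is m + 1 and is removed, or all parts are at most m.
    Removing it keeps the bound m + 1 but lowers i, hence the induction on m + i. *)
Lemma enum_regular_partitions m i : (i <= n)%N ->
  exists s : seq (seq nat), [/\ uniq s,
    forall t, (t \in s) = [&& is_regular_partition l t, all (fun y => y <= m)%N t & sumn t == i]
    & (size s)%:R = (parts_gf m)`_i].
Proof.
have [k] := ubnP (m + i); elim: k m i => // k IH [|m] i; rewrite ltnS => mik iN.
  exists (if i == 0 then [:: [::]] else [::]); split; first by case: ifP.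
    case=> [|x t]; first by rewrite /= eq_sym; case: ifP.
    rewrite regular_partition_cons /= leqn0; case: (x) => [|y]; last by rewrite /= andbF; case: ifP.
    by rewrite /=; case: ifP.
  by rewrite coef1; case: ifP.
have [s [us ms ss]] := IH m i ltac:(lia) iN.
rewrite /=; case: ifP => lm.
  exists s; split => //; last by rewrite mulr1.
  move=> t; rewrite ms; case: (boolP (is_regular_partition l t)) => //= /andP[_ /allP ht].
  congr andb; apply/allP/allP => h y yt; first by rewrite leqW // h.
  by have := h y yt; rewrite leq_eqVlt ltnS => /predU1P[e|//]; have := ht y yt; rewrite e lm.
have rec : (parts_gf m.+1 * (1 - 'X^(m.+1)))`_i = (parts_gf m)`_i.
  rewrite /= lm -mulrA; have := eqmXM (@eqmX_refl _ n.+1 (parts_gf m)) (geometric_eqmX (isT : (0 < m.+1)%N)).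
  by move/(_ i iN); rewrite mulr1.
move: rec; rewrite [parts_gf m.+1]/= lm mulrBr mulr1 coefB coefMXn => rec.
have small t : (i < m.+1)%N -> [&& is_regular_partition l t, all (fun y => y <= m.+1)%N t & sumn t == i]
   = [&& is_regular_partition l t, all (fun y => y <= m)%N t & sumn t == i].
  move=> im; congr andb; apply/andP/andP => -[/allP h /eqP e]; split; try exact/eqP.
    apply/allP => y yt; rewrite -ltnS (leq_ltn_trans _ im) // -e.
    by rewrite (perm_sumn (perm_to_rem yt)) leq_addr.
  by apply/allP => y /h; apply: leqW.
case: ltnP rec => im rec.
  exists s; split; rewrite // ?ss -?rec ?subr0 //.
  by move=> t; rewrite ms small.
have [s' [us' ms' ss']] := IH m.+1 (i - m.+1)%N ltac:(lia) ltac:(lia).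
exists (s ++ map (cons m.+1) s'); split.
- rewrite cat_uniq us map_inj_uniq ?us' ?andbT => [|x y [] //].
  apply/hasPn => t /mapP[u _ ->]; rewrite ms /= ltnn !andbF //.
- move=> t; rewrite mem_cat ms; apply/orP/idP.
    case=> [/and3P[h1 /allP h2 h3]|/mapP[u]].
      by rewrite h1 h3 andbT /=; apply/allP => y /h2; apply: leqW.
    rewrite ms' => /and3P[h1 h2 /eqP h3] ->.
    by rewrite regular_partition_cons lm h1 h2 /= leqnn h2 h3 subnKC // eqxx.
  case: t => [|x t]; first by move=> h; left.
  rewrite regular_partition_cons /= => /and3P[/and4P[x0 lx tx rt] /andP[xm tm] /eqP e].
  move: xm; rewrite leq_eqVlt => /predU1P[ex|xm].
    right; apply/mapP; exists t; last by rewrite ex.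
    by rewrite ms' rt tm /= -e ex addKn.
  rewrite ltnS in xm; have tm' : all (fun y => y <= m)%N t.
    by apply/allP => y yt; apply: leq_trans (allP tx y yt) xm.
  by left; apply/and3P; rewrite x0 lx tx rt xm tm' e.
by rewrite size_cat size_map natrD ss ss' -[RHS](subrK ((parts_gf m.+1)`_(i - m.+1))) /= lm rec.
Qed.

Lemma regular_gf_parts : eqmX n.+1 regular_gf (parts_gf n).
Proof.
move=> i; rewrite ltnS => iN; have [s [us ms <-]] := enum_regular_partitions n iN.
rewrite /regular_gf coef_sum; under eq_bigr do rewrite coefXn.
rewrite -natr_sum -big_mkcondr /= sum1dep_card; congr (_%:R).
rewrite cardE -(size_map (@bseq_nat n)); apply: perm_size; apply: uniq_perm => //.
  by rewrite (map_inj_uniq (@bseq_nat_inj n)) enum_uniq.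
move=> t; rewrite ms; apply/mapP/and3P.
  case=> u; rewrite mem_enum inE => /andP[ru /eqP ->] ->; split => //.
  by apply/allP => y /mapP[z _ ->]; rewrite -ltnS.
case=> rt _ /eqP e; have [|u uE] := @bseq_nat_surj n t (proj1 (andP rt)); first by rewrite e.
by exists u => //; rewrite mem_enum inE uE rt e eqxx.
Qed.

Theorem regular_gf_euler :
  eqmX n.+1 (regular_gf * euler R 1 n) (euler R l n).
Proof.
apply: eqmX_trans (eqmXM regular_gf_parts (@eqmX_refl _ _ _)) _.
apply: eqmX_trans (parts_gf_euler n) _; apply: eqmX_sym.
apply: eqmX_le (@euler_eqmX R l (n %/ l) n (leq_div _ _)).
by rewrite mulnC ltn_ceil.
Qed.

End Counting.

(** * The two congruences *)

Lemma euler_Frobenius p n : prime p -> euler 'F_p p n = euler 'F_p 1 n ^+ p.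
Proof.
move=> pp; have ch : p \in [pchar {poly 'F_p}] by rewrite pchar_poly pchar_Fp.
rewrite /euler -(pFrobenius_autE ch) rmorph_prod; apply: eq_bigr => i _.
by rewrite rmorphB rmorph1 /= pFrobenius_autE mul1n -exprM mulnC.
Qed.

Lemma B5_sigma n : (B 5 6 n)%:R = (n.+1 * sigma n.+1)%:R :> 'F_5.
Proof.
rewrite -(@tau_mod5 n.+1) // (@eqmX_exp _ n.+1 24 _ _ (@euler1_eqmX _ n n.+1 _)) //.
rewrite -coef_regular_gf_exp.
suff h : eqmX n.+1 (regular_gf 'F_5 5 n ^+ 6) (euler 'F_5 1 n ^+ 24) by exact: h.
apply: (@eqmX_mulI _ _ _ _ (euler 'F_5 1 n ^+ 6)).
  by rewrite -horner_coef0 horner_exp horner_coef0 euler_coef0 ?expr1n.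
have := eqmX_exp 6 (@regular_gf_euler 'F_5 5 n isT).
by rewrite euler_Frobenius // exprMn mulrC -!exprM -exprD.
Qed.

Lemma B7_euler n : (B 7 6 n)%:R = (euler 'F_7 7 n ^+ 5 * euler 'F_7 1 n)`_n.
Proof.
rewrite -coef_regular_gf_exp.
suff h : eqmX n.+1 (regular_gf 'F_7 7 n ^+ 6) (euler 'F_7 7 n ^+ 5 * euler 'F_7 1 n) by exact: h.
apply: (@eqmX_mulI _ _ _ _ (euler 'F_7 1 n ^+ 6)).
  by rewrite -horner_coef0 horner_exp horner_coef0 euler_coef0 ?expr1n.
have := eqmX_exp 6 (@regular_gf_euler 'F_7 7 n isT).
rewrite exprMn mulrC; congr eqmX.
by rewrite [in RHS]mulrCA -exprSr -(@euler_Frobenius 7) // -exprSr.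
Qed.

(** E_7^5 has only exponents divisible by 7, so index 7n + 2 pairs them with exponents of E_1 that
    are 2 mod 7. After X^7 becomes X this is - E_1^5 E_7, and E_7 = E_1^7 modulo 7. *)
Lemma B7_euler12 n : (B 7 6 (7 * n + 2))%:R = - (euler 'F_7 1 n ^+ 12)`_n.
Proof.
set M := (7 * n + 2)%N; rewrite B7_euler euler_comp -rmorphXn /=.
set A := euler 'F_7 1 M ^+ 5.
have -> : ((A \Po 'X^7) * euler 'F_7 1 M)`_M = \sum_(i < n.+1) A`_i * (euler 'F_7 1 M)`_(7 * (n - i) + 2).
  rewrite coefM.
  transitivity (\sum_(j <- iota 0 M.+1 | (7 %| j)%N) A`_(j %/ 7) * (euler 'F_7 1 M)`_(M - j)).
    rewrite -[iota 0 M.+1]/(index_iota 0 M.+1) big_mkord [RHS]big_mkcond; apply: eq_bigr => j _.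
    by rewrite coef_comp_poly_Xn //; case: ifP => _; rewrite ?mul0r.
  transitivity (\sum_(i <- iota 0 n.+1) A`_i * (euler 'F_7 1 M)`_(7 * (n - i) + 2)); last first.
    by rewrite -[iota 0 n.+1]/(index_iota 0 n.+1) big_mkord.
  rewrite -big_filter (@big_seq_bij _ _ _ (iota 0 n.+1) _ (fun i => 7 * i)%N (fun j => j %/ 7)%N) //.
  - apply: eq_big_seq => i; rewrite mem_iota => hi; rewrite mulKn //.
    by congr (_ * _`_ _); rewrite /M mulnBr; lia.
  - exact: iota_uniq.
  - by rewrite filter_uniq ?iota_uniq.
  - by move=> i; rewrite mem_filter !mem_iota dvdn_mulr //= /M; lia.
  - by move=> j; rewrite mem_filter !mem_iota /M; lia.
  - by move=> i _; rewrite mulKn.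
  - by move=> j; rewrite mem_filter => /andP[h _]; rewrite mulnC divnK.
transitivity (- (A * euler 'F_7 7 M)`_n).
  rewrite coefM -sumrN; apply: eq_bigr => i _.
  by rewrite coef_euler_7k2 ?mulrN // leq_add2r leq_mul2l leq_subr.
congr (- _); rewrite euler_Frobenius // /A -exprD.
by apply: (@eqmX_exp _ n.+1 12) => //; apply: euler1_eqmX; rewrite /M; lia.
Qed.

Lemma B7_hsum n : (B 7 6 (7 * n + 2))%:R = - (hsum n.*2.+1)%:~R :> 'F_7.
Proof.
rewrite B7_euler12 hsum_euler12 rmorphM /=; congr (- _).
rewrite -[X in X * _](_ : 1 = _) ?mul1r; last exact/val_inj.
have -> : euler 'F_7 1 n ^+ 12 = map_poly intr (euler int 1 n ^+ 12).
  by rewrite rmorphXn /= map_euler.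
by rewrite coef_map.
Qed.

Lemma hsum_p4 (p m : nat) : prime p -> odd p -> p <> 7 -> (hsum p)%:~R = 0 :> 'F_7 ->
  (hsum (p ^ 4 * m))%:~R = p%:R ^+ 4 * (hsum m)%:~R :> 'F_7.
Proof.
move=> pp op p7 h0; have p0 := prime_gt0 pp.
have eight : 8%:~R = 1 :> 'F_7 by apply: val_inj.
(* The Hecke relation at N = pk with vanishing h(p). *)
have step k : (hsum (p ^ 2 * k))%:~R = - (p%:R ^+ 5 * (hsum k)%:~R) :> 'F_7.
  have := congr1 (fun z => z%:~R : 'F_7) (hecke_hsum (p * k) pp op); cbv beta.
  rewrite dvdn_mulr // mulKn // intrM h0 mulr0 => /esym.
  rewrite intrM intrD intrM eight mul1r mulnA => /eqP.
  rewrite addr_eq0 => /eqP ->; congr (- (_ * _)).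
  by rewrite rmorphXn /= -pmulrn.
have p6 : p%:R ^+ 6 = 1 :> 'F_7.
  have nz : p%:R != 0 :> 'F_7.
    by rewrite -(dvdn_pcharf (pchar_Fp (isT : prime 7))) dvdn_prime2 //; apply/eqP => e; apply: p7.
  have := expf_card (p%:R : 'F_7); rewrite card_Fp // exprS => /eqP.
  by rewrite -[X in _ == X]mulr1 => /eqP/(mulfI nz).
have -> : (p ^ 4 = p ^ 2 * p ^ 2)%N by rewrite -expnD.
rewrite -mulnA !step mulrN opprK mulrA -exprD (_ : 5 + 5 = 6 + 4)%N // exprD p6 mul1r //.
Qed.

Lemma B5_congruence p n t : prime p -> p <> 5 -> (B 5 6 (p - 1) = 0 %[mod 5])%N ->
  (B 5 6 (p ^ (4 * t) * n + (p ^ (4 * t) - 1)) = p ^ (2 * t) * B 5 6 n %[mod 5])%N.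
Proof.
move=> pp p5 h; have p0 := prime_gt0 pp.
have {}h : (p * sigma p = 0 %[mod 5])%N.
  apply: Fp_nat_eq => //; have := B5_sigma (p - 1); rewrite subn1 prednK // => <-.
  by apply: nat_eq_Fp => //; rewrite -subn1.
have main s m : (0 < m)%N -> (p ^ (4 * s) * m * sigma (p ^ (4 * s) * m) = p ^ (2 * s) * (m * sigma m) %[mod 5])%N.
  move=> m0; elim: s => [|s IH]; first by rewrite !muln0 !expn0 !mul1n.
  have pm0 : (0 < p ^ (4 * s) * m)%N by rewrite muln_gt0 expn_gt0 p0.
  have -> : (p ^ (4 * s.+1) * m = p ^ 4 * (p ^ (4 * s) * m))%N by rewrite mulnS expnD mulnA.
  by rewrite nsigma_p4_mod5 // -modnMmr IH modnMmr mulnA -expnD mulnS.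
apply: Fp_nat_eq => //; rewrite natrM !B5_sigma -natrM.
have pt0 : (0 < p ^ (4 * t))%N by rewrite expn_gt0 p0.
have -> : ((p ^ (4 * t) * n + (p ^ (4 * t) - 1)).+1 = p ^ (4 * t) * n.+1)%N.
  by rewrite -addnS -subSn // subn1 mulnSr.
by apply: nat_eq_Fp => //; apply: main.
Qed.

Lemma B7_congruence p n t : prime p -> odd p -> p <> 7 ->
  (B 7 6 ((7 * p - 3) %/ 2) = 0 %[mod 7])%N ->
  (B 7 6 (7 * p ^ (4 * t) * n + (7 * p ^ (4 * t) - 3) %/ 2)
    = p ^ (4 * t) * B 7 6 (7 * n + 2) %[mod 7])%N.
Proof.
move=> pp op p7 h.
(* For q = 2m + 1 the index is 7m + 2, so the hypothesis is about h(p) itself. *)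
have idx q : odd q -> ((7 * q - 3) %/ 2 = 7 * q./2 + 2)%N.
  by move=> oq; rewrite -{1}(odd_double_half q) oq; lia.
have h0 : (hsum p)%:~R = 0 :> 'F_7.
  have := B7_hsum p./2; have -> : (p./2.*2.+1 = p)%N by rewrite -[RHS]odd_double_half op.
  rewrite -idx // (nat_eq_Fp (isT : prime 7) h) => /esym/eqP.
  by rewrite oppr_eq0 => /eqP.
have main s m : (hsum (p ^ (4 * s) * m))%:~R = p%:R ^+ (4 * s) * (hsum m)%:~R :> 'F_7.
  elim: s => [|s IH]; first by rewrite muln0 expn0 expr0 mul1n mul1r.
  have -> : (p ^ (4 * s.+1) * m = p ^ 4 * (p ^ (4 * s) * m))%N by rewrite mulnS expnD mulnA.
  by rewrite hsum_p4 // IH mulrA -exprD mulnS.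
have oq : odd (p ^ (4 * t)) by rewrite oddX op orbT.
apply: Fp_nat_eq => //; rewrite natrM B7_hsum natrX mulrN -main idx //.
have -> : (7 * p ^ (4 * t) * n + (7 * (p ^ (4 * t))./2 + 2) = 7 * (p ^ (4 * t) * n + (p ^ (4 * t))./2) + 2)%N.
  by rewrite addnA -mulnA -mulnDr.
rewrite B7_hsum; congr (- (hsum _)%:~R).
have e := odd_double_half (p ^ (4 * t)); rewrite oq add1n in e.
by rewrite mulnS -doubleMr doubleD -addnS e addnC.
Qed.

Local Close Scope ring_scope.
Theorem theorem1p3 (n t : nat) :
  (forall p : nat, prime p -> p <> 5 ->
     B 5 6 (p - 1) = 0 %[mod 5] ->
     B 5 6 (p ^ (4 * t) * n + (p ^ (4 * t) - 1))
       = p ^ (2 * t) * B 5 6 n %[mod 5])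
  /\
  (forall p : nat, prime p -> odd p -> p <> 7 ->
     B 7 6 ((7 * p - 3) %/ 2) = 0 %[mod 7] ->
     B 7 6 (7 * p ^ (4 * t) * n + (7 * p ^ (4 * t) - 3) %/ 2)
       = p ^ (4 * t) * B 7 6 (7 * n + 2) %[mod 7]).
Proof.
split=> p pp; first exact: B5_congruence.
exact: B7_congruence.
Qed.
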